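(* Let $m_\alpha$ denote the median of $\mathbf{Z}_\alpha$ for $\alpha\in(0,1)$, and $m_{\mathbf{S}}$ the median of $\mathbf{S}$. The function $\alpha\mapsto m_\alpha$ increases on $(1-m_{\mathbf{S}},1)$.
   Context: For $\alpha\in(0,1)$, $\mathbf{Z}_\alpha$ is the positive random variable with $\mathbb{E}[e^{-\lambda \mathbf{Z}_\alpha}]=e^{-\lambda^\alpha}$ for all $\lambda\ge0$. $\mathbf{S}=e^{\mathbf{X}}$, where $\mathbf{X}$ is the real random variable with characteristic function $\mathbb{E}[e^{\mathrm{i}\lambda\mathbf{X}}]=e^{\mathrm{i}\lambda(\log|\lambda|-1)-\pi|\lambda|/2}$, $\lambda\in\mathbb{R}$. For a real random variable $X$ whose density does not vanish on its support, its median $m_X$ is the unique number with $\mathbb{P}[X\le m_X]=\mathbb{P}[X\ge m_X]=\frac12$. *)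

(* Defs.v *)
From HB Require Import structures.
From mathcomp Require Export all_boot all_order all_algebra.
From mathcomp Require Export all_classical all_reals all_analysis.
From mathcomp Require Export complex.

Set Implicit Arguments.
Unset Strict Implicit.
Unset Printing Implicit Defensive.

Export Order.TTheory GRing.Theory Num.Theory.
Export numFieldNormedType.Exports.

#[export] Set Implicit Arguments.
#[export] Unset Strict Implicit.
#[export] Unset Printing Implicit Defensive.

#[global] Open Scope classical_set_scope.
#[global] Open Scope ring_scope.
#[global] Open Scope complex_scope.

Definition cexp (R : realType) (z : R[i]) : R[i] :=
  (expR (complex.Re z) * cos (complex.Im z))
  +i* (expR (complex.Re z) * sin (complex.Im z)).

(* Complex-valued expectation, taken componentwise; meaningful when both parts
   have a finite expectation, as for the bounded function e^(i l X) below. *)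
Definition cexpectation (d : measure_display) (T : measurableType d)
    (R : realType) (P : probability T R) (Y : T -> R[i]) : R[i] :=
  fine 'E_P[fun w => complex.Re (Y w)]%E
  +i* fine 'E_P[fun w => complex.Im (Y w)]%E.

Definition char_fun (d : measure_display) (T : measurableType d)
    (R : realType) (P : probability T R) (X : {RV P >-> R}) (l : R) : R[i] :=
  cexpectation P (fun w => cexp ('i * (l * X w)%:C)).

(* Z is (a version of) the positive alpha-stable variable Z_alpha. *)
Definition is_positive_stable (d : measure_display) (T : measurableType d)
    (R : realType) (P : probability T R) (alpha : R) (Z : {RV P >-> R}) : Prop :=
  (\forall w \ae P, 0 < Z w) /\
  forall l : R, 0 <= l ->
    'E_P[fun w => expR (- (l * Z w))%R]%E = (expR (- (l `^ alpha)))%:E.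

(* X has the law of log S. At l = 0 the exponent is 0, since [ln 0] is finite
   by convention and is multiplied by 0. *)
Definition is_log_S (d : measure_display) (T : measurableType d)
    (R : realType) (P : probability T R) (X : {RV P >-> R}) : Prop :=
  forall l : R,
    char_fun X l =
    cexp ('i * (l * (ln `|l| - 1))%:C - (pi * `|l| / 2)%:C).

(* Uniqueness of m is not part of the predicate: it is a property of the laws
   at hand (their densities do not vanish on their supports), not an
   assumption. *)
Definition is_median (d : measure_display) (T : measurableType d)
    (R : realType) (P : probability T R) (X : T -> R) (m : R) : Prop :=
  P [set w | X w <= m] = (2^-1)%:E /\ P [set w | m <= X w] = (2^-1)%:E.

(* Main.v *)
Require Import Defs.
From mathcomp Require Import ring lra measurable_realfun.

(** Write S y for the integral over b of E sin (e^b (Y - y)); S y1 - S y2 is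
    pi/2 times E (sg (Y - y1) - sg (Y - y2)) (Gil-Pelaez, with l = e^b).  For
    Y = - Z_alpha and Y = log S, deforming the contour onto the curve on which
    the phase vanishes gives
      S y = int_0^pi exp (- kappa(y) B(u)) du - pi/2,
    with B Zolotarev's function; letting y1 tend to -oo, the median m of Y is
    characterised by int_0^pi exp (- kappa(m) B(u)) du = pi/2.  Up to an additive
    constant, ln B is ln_zolotarev alpha (resp. ln_zolotarev_S), a nonnegative
    function that increases with alpha and is bounded above by ln_zolotarev_S.
    Hence the weight w_alpha = stable_weight alpha m_alpha decreases with alpha
    and stays above m_S, and
      ln m_alpha = ln alpha + (1 - alpha) / alpha * (ln (1 - alpha) - ln w_alpha)
    increases as long as 1 - alpha < m_S <= w_alpha. *)

(** * Differentiation and continuity rules *)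

(** The hypothesis on Z_alpha gives its Laplace transform on the real half-line only, whereas
    Gil-Pelaez inversion needs E exp (- l Z) at l = i e^b. Passing from one to the other is the main
    obstacle; it is done by averaging against Gaussians in the variable log l, moved between height
    pi/2 and the real line by Cauchy's theorem on a rectangle. The same theorem, in coordinates
    where the zero-phase curve becomes x = 0, serves for the deformation of the contour. The
    variable b = log l turns dl / l into db, and the rotation of l by i into a vertical translation
    by pi/2. On the zero-phase curve the integrand is a positive, decreasing function of kappa(y)
    B(u), so two medians can be compared as soon as two functions B can, without densities or
    explicit medians. The bound 1 - alpha < m_S enters through the derivative in alpha of the last
    formula with w frozen, which is (ln w - ln (1 - alpha)) / alpha^2. *)

Section derive_rules.
Context {R : realType}.
Implicit Types (f g : R -> R) (x : R).

Lemma is_derive_fexp f x df : is_derive x 1 f df ->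
  is_derive x 1 (fun t => expR (f t)) (expR (f x) * df).
Proof. by move=> fd; have := @is_derive1_comp _ expR f x _ _ (is_derive_expR _) fd. Qed.

Lemma is_derive_fsin f x df : is_derive x 1 f df ->
  is_derive x 1 (fun t => sin (f t)) (cos (f x) * df).
Proof. by move=> fd; have := @is_derive1_comp _ sin f x _ _ (is_derive_sin _) fd. Qed.

Lemma is_derive_fcos f x df : is_derive x 1 f df ->
  is_derive x 1 (fun t => cos (f t)) (- sin (f x) * df).
Proof. by move=> fd; have := @is_derive1_comp _ cos f x _ _ (is_derive_cos _) fd. Qed.

Lemma is_derive_fln f x df : 0 < f x -> is_derive x 1 f df ->
  is_derive x 1 (fun t => ln (f t)) ((f x)^-1 * df).
Proof. by move=> f0 fd; have := @is_derive1_comp _ (@ln R) f x _ _ (is_derive1_ln f0) fd. Qed.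

Lemma is_derive_fM f g x df dg : is_derive x 1 f df -> is_derive x 1 g dg ->
  is_derive x 1 (fun t => f t * g t) (f x * dg + g x * df).
Proof. by move=> fd gd; exact: is_deriveM. Qed.

Lemma is_derive_fD f g x df dg : is_derive x 1 f df -> is_derive x 1 g dg ->
  is_derive x 1 (fun t => f t + g t) (df + dg).
Proof. by move=> fd gd; exact: is_deriveD. Qed.

Lemma is_derive_fN f x df : is_derive x 1 f df ->
  is_derive x 1 (fun t => - f t) (- df).
Proof. by move=> fd; exact: is_deriveN. Qed.

Lemma is_derive_fV f x df : f x != 0 -> is_derive x 1 f df ->
  is_derive x 1 (fun t => (f t)^-1) (- df / (f x) ^+ 2).
Proof.
move=> f0 fd.
have dx : derivable f x 1 by exact: ex_derive.
have h := derivableV f0 dx.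
apply: DeriveDef => //; rewrite deriveV//.
by rewrite derive_val /GRing.scale/= mulNr mulrC mulNr.
Qed.

Lemma is_derive_fsqr f x df : is_derive x 1 f df ->
  is_derive x 1 (fun t => f t ^+ 2) (2 * f x * df).
Proof.
move=> fd; have -> : 2 * f x * df = f x * df + f x * df by ring.
exact: is_derive_fM.
Qed.

Lemma is_derive_fcst (c x : R) : is_derive x 1 (fun _ : R => c) 0.
Proof. exact: is_derive_cst. Qed.

Lemma is_derive_fid x : is_derive x 1 (fun t : R => t) 1.
Proof. exact: is_derive_id. Qed.

Lemma is_derive_cont f x df : is_derive x 1 f df -> {for x, continuous f}.
Proof.
by move=> fd; apply/differentiable_continuous/derivable1_diffP; exact: ex_derive.
Qed.

Lemma is_derive_mull (c x : R) : is_derive x 1 ( *%R c) c.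
Proof.
have h := is_derive_fM (is_derive_fcst c x) (is_derive_fid x).
by rewrite mulr0 addr0 mulr1 in h.
Qed.

Lemma is_derive_addl (c x : R) : is_derive x 1 ( +%R c) 1.
Proof.
have h := is_derive_fD (is_derive_fcst c x) (is_derive_fid x).
by rewrite add0r in h.
Qed.

Lemma is_derive_congr f x a b : is_derive x 1 f a -> a = b -> is_derive x 1 f b.
Proof. by move=> + <-. Qed.

End derive_rules.

(* [is_derive] is a type class: plain [refine] would start an instance search
   on the derivative left as an existential variable. *)
Ltac der :=
  match goal with
  | |- is_derive _ _ (fun _ => ?c) _ => notypeclasses refine (is_derive_fcst _ _)
  | |- is_derive _ _ (fun t => t) _ => notypeclasses refine (is_derive_fid _)
  | |- is_derive _ _ (fun t => _ + _) _ => notypeclasses refine (is_derive_fD _ _); [der | der]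
  | |- is_derive _ _ (fun t => _ * _) _ => notypeclasses refine (is_derive_fM _ _); [der | der]
  | |- is_derive _ _ (fun t => - _) _ => notypeclasses refine (is_derive_fN _); der
  | |- is_derive _ _ (fun t => _ ^+ 2) _ => notypeclasses refine (is_derive_fsqr _); der
  | |- is_derive _ _ (fun t => expR _) _ => notypeclasses refine (is_derive_fexp _); der
  | |- is_derive _ _ (fun t => sin _) _ => notypeclasses refine (is_derive_fsin _); der
  | |- is_derive _ _ (fun t => cos _) _ => notypeclasses refine (is_derive_fcos _); der
  | |- is_derive _ _ (fun t => _^-1) _ => notypeclasses refine (is_derive_fV _ _); [ | der]
  | |- is_derive _ _ (fun t => ln _) _ => notypeclasses refine (is_derive_fln _ _); [ | der]
  | |- is_derive _ _ ( *%R _) _ => notypeclasses refine (is_derive_mull _ _)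
  | |- is_derive _ _ ( +%R _) _ => notypeclasses refine (is_derive_addl _ _)
  | |- is_derive _ _ (-%R) _ => notypeclasses refine (is_derive_fN (is_derive_fid _))
  | |- is_derive _ _ expR _ => notypeclasses refine (is_derive_expR _)
  | |- is_derive _ _ sin _ => notypeclasses refine (is_derive_sin _)
  | |- is_derive _ _ cos _ => notypeclasses refine (is_derive_cos _)
  | |- _ => eassumption
  | |- _ => idtac
  end.

Ltac derive := notypeclasses refine (is_derive_congr _ _); [der | cbn beta].
Ltac derive_ring := derive; ring.

Lemma continuous_mull (R : realType) (c : R) : continuous ( *%R c).
Proof. by move=> x; exact: mulrl_continuous. Qed.

Lemma continuous_addl (R : realType) (c : R) : continuous ( +%R c).
Proof. by move=> x; apply: (@cvgD _ _ _ _ _ (fun=> c) id); [exact: cvg_cst|exact: cvg_id]. Qed.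

Lemma continuous_opp (R : realType) : continuous (@GRing.opp R).
Proof. by move=> x; exact: opp_continuous. Qed.

Section continuous_rules.
Context {R : realType} {T : topologicalType}.
Implicit Types (f g : T -> R) (x : T).

Lemma continuous_at_fcst (c : R) x : continuous_at x (fun _ : T => c).
Proof. exact: cst_continuous. Qed.

Lemma continuous_at_fD f g x : continuous_at x f -> continuous_at x g ->
  continuous_at x (fun t => f t + g t).
Proof. by move=> cf cg; exact: cvgD. Qed.

Lemma continuous_at_fM f g x : continuous_at x f -> continuous_at x g ->
  continuous_at x (fun t => f t * g t).
Proof. by move=> cf cg; exact: cvgM. Qed.

Lemma continuous_at_fN f x : continuous_at x f -> continuous_at x (fun t => - f t).
Proof. by move=> cf; exact: cvgN. Qed.

Lemma continuous_at_fV f x : f x != 0 -> continuous_at x f ->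
  continuous_at x (fun t => (f t)^-1).
Proof. by move=> f0 cf; exact: cvgV. Qed.

Lemma continuous_at_fcomp (h : R -> R) f x : continuous_at (f x) h ->
  continuous_at x f -> continuous_at x (fun t => h (f t)).
Proof. by move=> ch cf; exact: continuous_comp. Qed.

Lemma continuous_at_fX f n x : continuous_at x f ->
  continuous_at x (fun t => f t ^+ n).
Proof. move=> cf; apply: (continuous_at_fcomp (h := fun y => y ^+ n)) => //.
exact: exprn_continuous. Qed.

Lemma continuous_at_fexp f x : continuous_at x f ->
  continuous_at x (fun t => expR (f t)).
Proof. by move=> cf; apply: continuous_at_fcomp => //; exact: continuous_expR. Qed.

Lemma continuous_at_fsin f x : continuous_at x f ->
  continuous_at x (fun t => sin (f t)).
Proof. by move=> cf; apply: continuous_at_fcomp => //; exact: continuous_sin. Qed.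

Lemma continuous_at_fcos f x : continuous_at x f ->
  continuous_at x (fun t => cos (f t)).
Proof. by move=> cf; apply: continuous_at_fcomp => //; exact: continuous_cos. Qed.

End continuous_rules.

Ltac cont :=
  match goal with
  | |- continuous_at _ (fun _ => ?c) => apply: continuous_at_fcst
  | |- continuous_at _ (fun t => t) => apply: cvg_id
  | |- continuous_at _ (fun t => t.1) => apply: cvg_fst
  | |- continuous_at _ (fun t => t.2) => apply: cvg_snd
  | |- continuous_at _ fst => apply: cvg_fst
  | |- continuous_at _ snd => apply: cvg_snd
  | |- continuous_at _ (fun t => _ + _) => apply: continuous_at_fD; [cont | cont]
  | |- continuous_at _ (fun t => _ * _) => apply: continuous_at_fM; [cont | cont]
  | |- continuous_at _ (fun t => - _) => apply: continuous_at_fN; cont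
  | |- continuous_at _ (fun t => _ ^+ _) => apply: continuous_at_fX; cont
  | |- continuous_at _ (fun t => expR _) => apply: continuous_at_fexp; cont
  | |- continuous_at _ (fun t => sin _) => apply: continuous_at_fsin; cont
  | |- continuous_at _ (fun t => cos _) => apply: continuous_at_fcos; cont
  | |- continuous_at _ ( *%R _) => apply: continuous_mull
  | |- continuous_at _ ( +%R _) => apply: continuous_addl
  | |- continuous_at _ (-%R) => apply: continuous_opp
  | |- continuous_at _ expR => apply: continuous_expR
  | |- continuous_at _ sin => apply: continuous_sin
  | |- continuous_at _ cos => apply: continuous_cos
  | |- continuous_at _ (fun t => ?g (@?f t)) =>
      apply: (continuous_at_fcomp (h := g)); [ idtac | cont]
  | |- _ => idtac
  end.

(** * Cauchy's theorem on rectangles *)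

Section segments.
Context {R : realType}.
Notation mu := (@lebesgue_measure R).

(** Compactness of the rectangle; the bound serves as a dominating constant, in particular when
    differentiating under the integral sign. *)
Lemma rect_bounded (h : R -> R -> R) (x0 x1 y0 y1 : R) :
  (forall x y, y0 <= y <= y1 -> continuous_at (x, y) (fun z : R * R => h z.1 z.2)) ->
  exists M, forall x y, x0 <= x <= x1 -> y0 <= y <= y1 -> `|h x y| <= M.
Proof.
move=> ch.
have cK : compact (`[x0, x1]%classic `*` `[y0, y1]%classic : set (R * R)).
  by apply: compact_setX; exact: segment_compact.
have cf : {within `[x0, x1]%classic `*` `[y0, y1]%classic,
    continuous (fun z : R * R => h z.1 z.2)}.
  apply: continuous_in_subspaceT => -[x y]; rewrite inE/= !in_itv/= => -[_ yy].
  exact: ch.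
have /compact_bounded[M [_ HM]] := continuous_compact cf cK.
exists (M + 1) => x y xx yy; apply: (HM (M + 1)); first by rewrite ltrDl.
by exists (x, y) => //=; rewrite !in_itv.
Qed.

Lemma continuous_integrable (f : R -> R) (a b : R) : continuous f ->
  mu.-integrable `[a, b] (EFin \o f).
Proof.
move=> cf; apply: continuous_compact_integrable; first exact: segment_compact.
exact: continuous_subspaceT.
Qed.

Lemma FTC_Rintegral (f F : R -> R) (a b : R) : a <= b ->
  (forall x, a <= x <= b -> is_derive x 1 F (f x)) ->
  (forall x, a <= x <= b -> continuous_at x f) ->
  \int[mu]_(x in `[a, b]) f x = F b - F a.
Proof.
rewrite le_eqVlt => /predU1P[-> _ _|ab dF cf].
  by rewrite set_itv1 Rintegral_set1 subrr.
have cF x : a <= x <= b -> continuous_at x F.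
  by move=> xab; have := dF _ xab; exact: is_derive_cont.
rewrite /Rintegral (@continuous_FTC2 _ f F)//.
- apply: continuous_in_subspaceT => x; rewrite inE/= in_itv/=; exact: cf.
- split.
  + move=> x; rewrite in_itv/= => /andP[ax xb].
    by apply: (@ex_derive _ _ _ _ _ _ (f x)); apply: dF; rewrite !ltW.
  + by apply: cvg_at_right_filter; apply: cF; rewrite lexx ltW.
  + by apply: cvg_at_left_filter; apply: cF; rewrite lexx ltW.
- move=> x; rewrite in_itv/= => /andP[ax xb].
  rewrite derive1E; apply: derive_val; apply: dF; by rewrite !ltW.
Qed.

End segments.

Section green.
Context {R : realType}.
Notation mu := (@lebesgue_measure R).

(** The form f dx + g dy is closed, [h] being the common value of the two cross derivatives.
    Differentiating under the integral sign, the integral of f over [x0, x1] has y-derivative the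
    integral of [h], which is g x1 y - g x0 y; it remains to integrate in y. The open strip around
    [y0, y1] leaves room for two-sided derivatives. *)
Lemma green (f g h : R -> R -> R) (u v x0 x1 y0 y1 : R) :
  x0 <= x1 -> u < y0 -> y0 <= y1 -> y1 < v ->
  (forall x y : R, u < y < v -> is_derive y 1 (f x) (h x y)) ->
  (forall x y : R, u < y < v -> is_derive x 1 (g^~ y) (h x y)) ->
  (forall x y : R, u < y < v -> continuous_at (x, y) (fun z : R * R => h z.1 z.2)) ->
  (forall x y : R, u < y < v -> continuous_at x (f^~ y)) ->
  (forall x y : R, u < y < v -> continuous_at y (g x)) ->
  \int[mu]_(x in `[x0, x1]) f x y1 - \int[mu]_(x in `[x0, x1]) f x y0 =
  \int[mu]_(y in `[y0, y1]) (g x1 y - g x0 y).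
Proof.
move=> x01 uy0 y01 y1v df dg ch cf cg.
pose F y := \int[mu]_(x in `[x0, x1]) f x y.
have dF y : u < y < v -> is_derive y 1 F (g x1 y - g x0 y).
  move=> /andP[uy yv].
  (* A smaller closed strip around y, so that [h] is bounded on a compact rectangle and the bound
     dominates the difference quotients. *)
  have [u' /andP[uu' u'y]] : exists u', u < u' < y by exists ((u + y) / 2); lra.
  have [v' /andP[yv' v'v]] : exists v', y < v' < v by exists ((v + y) / 2); lra.
  have [M hM] : exists M : R, forall x z, x0 <= x <= x1 -> u' <= z <= v' ->
      `|h x z| <= M.
    by apply: rect_bounded => x z /andP[? ?]; apply: ch; lra.
  have M0 : 0 <= M.
    by apply: le_trans (hM x0 y _ _); rewrite ?lexx//; lra.
  have Iy : `]u', v'[%classic y by rewrite /= in_itv/= u'y.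
  have int_f z : `]u', v'[%classic z ->
      mu.-integrable `[x0, x1] (EFin \o (fun x => f x z)).
    rewrite /= in_itv/= => /andP[? ?]; apply: continuous_integrable => x.
    by apply: cf; lra.
  have d_f z x : `]u', v'[%classic z -> `[x0, x1]%classic x ->
      derivable (fun z => f x z) z 1.
    rewrite /= in_itv/= => /andP[? ?] _.
    by apply: (@ex_derive _ _ _ _ _ _ (h x z)); apply: df; lra.
  have iM : mu.-integrable `[x0, x1] (EFin \o (fun=> M)).
    by apply: continuous_integrable; exact: cst_continuous.
  have pE z x : u < z < v -> partial1of2 (fun z x => f x z) z x = h x z.
    by move=> zuv; rewrite partial1of2E; apply: derive_val; exact: df.
  have bM z x : `]u', v'[%classic z -> `[x0, x1]%classic x ->
      `|partial1of2 (fun z x => f x z) z x| <= M.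
    rewrite /= !in_itv/= => /andP[? ?] ?.
    by rewrite pE; [apply: hM => //; lra|lra].
  have D1 : derivable F y 1.
    exact: (derivable_under_integral _ Iy int_f d_f (G := fun=> M) _ iM bM).
  have D2 : 'D_1 F y = \int[mu]_(x in `[x0, x1]) partial1of2 (fun z x => f x z) y x.
    rewrite -derive1E.
    exact: (differentiation_under_integral _ Iy int_f d_f (G := fun=> M) _ iM bM).
  apply: DeriveDef; first exact: D1.
  rewrite D2.
  rewrite (_ : \int[mu]_(x in _) _ = \int[mu]_(x in `[x0, x1]) h x y); last first.
    by apply: eq_Rintegral => x _; rewrite pE// uy.
  notypeclasses refine (FTC_Rintegral (f := h^~ y) (F := g^~ y) x01 _ _) => x _.
    by have := dg x y; rewrite uy yv; apply.
  have c1 : continuous_at x (fun t : R => (t, y)).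
    by apply: (@cvg_pair _ _ _ _ (nbhs x) (nbhs y)); [exact: cvg_id|exact: cvg_cst].
  apply: (@continuous_comp _ _ _ _ (fun z : R * R => h z.1 z.2) _ c1).
  by apply: ch; rewrite uy.
have FE : \int[mu]_(y in `[y0, y1]) (g x1 y - g x0 y) = F y1 - F y0.
  notypeclasses refine (FTC_Rintegral y01 _ _) => y /andP[y0y yy1].
    have : u < y < v by lra.
    exact: dF.
  by apply: cvgB; apply: cg; lra.
by rewrite FE.
Qed.

(* Cauchy's theorem for [exp (P + i Q)], holomorphic in the coordinate
   [x + c y] where [c' = a' + i]: [a'] gives the slope of the curves [x = cst]. *)
Lemma cauchy_exp (P Q Px Qx : R -> R -> R) (a' : R -> R) (u v x0 x1 y0 y1 : R) :
  x0 <= x1 -> u < y0 -> y0 <= y1 -> y1 < v ->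
  (forall x y : R, u < y < v -> is_derive x 1 (P^~ y) (Px x y)) ->
  (forall x y : R, u < y < v -> is_derive x 1 (Q^~ y) (Qx x y)) ->
  (forall x y : R, u < y < v -> is_derive y 1 (P x) (a' y * Px x y - Qx x y)) ->
  (forall x y : R, u < y < v -> is_derive y 1 (Q x) (a' y * Qx x y + Px x y)) ->
  (forall x y : R, u < y < v -> continuous_at (x, y) (fun z : R * R => P z.1 z.2)) ->
  (forall x y : R, u < y < v -> continuous_at (x, y) (fun z : R * R => Q z.1 z.2)) ->
  (forall x y : R, u < y < v -> continuous_at (x, y) (fun z : R * R => Px z.1 z.2)) ->
  (forall x y : R, u < y < v -> continuous_at (x, y) (fun z : R * R => Qx z.1 z.2)) ->
  (forall y, u < y < v -> continuous_at y a') ->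
  let f x y := expR (P x y) * sin (Q x y) in
  let g x y := expR (P x y) * (a' y * sin (Q x y) + cos (Q x y)) in
  \int[mu]_(x in `[x0, x1]) f x y1 - \int[mu]_(x in `[x0, x1]) f x y0 =
  \int[mu]_(y in `[y0, y1]) (g x1 y - g x0 y).
Proof.
move=> x01 uy0 y01 y1v dPx dQx dPy dQy cP cQ cPx cQx ca f g.
(* With c' = a' + i, [f] and [g] are the imaginary parts of exp (P + i Q) and of c' exp (P + i Q).
   The assumptions on the y-derivatives say that P + i Q has y-derivative c' times its x-derivative,
   so both cross derivatives equal [h]. *)
pose h x y := expR (P x y) * ((a' y * Px x y - Qx x y) * sin (Q x y) +
  (a' y * Qx x y + Px x y) * cos (Q x y)).
have dP2 x y : u < y < v -> continuous_at y (P x).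
  by move=> /dPy => /(_ x) ?; apply: is_derive_cont; eassumption.
have dQ2 x y : u < y < v -> continuous_at y (Q x).
  by move=> /dQy => /(_ x) ?; apply: is_derive_cont; eassumption.
have dP1 x y : u < y < v -> continuous_at x (P^~ y).
  by move=> /dPx => /(_ x) ?; apply: is_derive_cont; eassumption.
have dQ1 x y : u < y < v -> continuous_at x (Q^~ y).
  by move=> /dQx => /(_ x) ?; apply: is_derive_cont; eassumption.
apply: (@green f g h u v) => //.
- move=> x y yuv; have h1 := dPy x y yuv; have h2 := dQy x y yuv.
  by rewrite /f /h; derive_ring.
- move=> x y yuv; have h1 := dPx x y yuv; have h2 := dQx x y yuv.
  by rewrite /g /h; derive_ring.
- move=> x y yuv; rewrite /h.
  have ca2 : continuous_at (x, y) (fun z : R * R => a' z.2).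
    by apply: (@continuous_comp _ _ _ snd a'); [exact: cvg_snd|exact: ca].
  by cont; auto.
- by move=> x y yuv; rewrite /f; cont; auto.
- by move=> x y yuv; rewrite /g; cont; auto.
Qed.

End green.

(** * Limits of integrals *)

Lemma cvgn_unique {R : realType} (u : nat -> R) (l l' : R) :
  u n @[n --> \oo] --> l -> u n @[n --> \oo] --> l' -> l = l'.
Proof. by move=> h1 h2; apply: (cvg_unique _ h1 h2). Qed.

Lemma cvgn_expRN {R : realType} (k : R) : 0 < k ->
  expR (- (k * n%:R)) @[n --> \oo] --> (0 : R).
Proof.
move=> k0; under eq_fun do rewrite mulrC.
apply: (cvg_comp (fun n => n%:R) (fun x => expR (- (x * k)))); first exact: cvgr_idn.
apply: (cvg_comp (fun x => x * k) (fun x => expR (- x))); last exact: cvgr_expR.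
by apply: gt0_cvgMly => //; exact: cvg_id.
Qed.

Lemma cvgn_norm0 {R : realType} (u v : nat -> R) : (forall n, `|u n| <= v n) ->
  v n @[n --> \oo] --> 0 -> u n @[n --> \oo] --> 0.
Proof.
move=> uv v0; apply: norm_cvg0.
apply: (@squeeze_cvgr _ _ _ _ (cst 0) v) => //; last exact: cvg_cst.
by apply: nearW => n; rewrite normr_ge0 uv.
Qed.

Section dominated.
Context d {T : measurableType d} {R : realType} (m : {measure set T -> \bar R}).

Lemma dominated_Rintegral (D : set T) (f_ : nat -> T -> R) (f g : T -> R) :
  measurable D -> (forall n, measurable_fun D (f_ n)) ->
  (forall x, D x -> f_ n x @[n --> \oo] --> f x) ->
  m.-integrable D (EFin \o g) ->
  (forall n x, D x -> `|f_ n x| <= g x) ->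
  \int[m]_(x in D) f_ n x @[n --> \oo] --> \int[m]_(x in D) f x.
Proof.
move=> mD mf_ f_f ig fg.
have mf : measurable_fun D f.
  by apply: (measurable_fun_cvg (h := f_)) => //.
have [|||||i1 _ c1] := @dominated_convergence _ _ _ m D mD
  (fun n => EFin \o f_ n) (EFin \o f) (EFin \o g).
- by move=> n; exact/measurable_EFinP.
- exact/measurable_EFinP.
- by apply: aeW => x Dx; apply: cvg_EFin; [exact: nearW|exact: f_f].
- exact: ig.
- by apply: aeW => x n Dx; rewrite lee_fin; exact: fg.
apply: fine_cvg; rewrite fineK//.
exact: integrable_fin_num.
Qed.

(** Dominated convergence with bound |f|. It reaches half-lines and half-open intervals from the
    compact intervals on which Cauchy's theorem applies. *)
Lemma cvg_Rintegral_sets (D : set T) (D_ : nat -> set T) (f : T -> R) :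
  measurable D -> (forall n, measurable (D_ n)) ->
  (forall n, D_ n `<=` D) -> (forall x, D x -> \forall n \near \oo, D_ n x) ->
  m.-integrable D (EFin \o f) ->
  \int[m]_(x in D_ n) f x @[n --> \oo] --> \int[m]_(x in D) f x.
Proof.
move=> mD mD_ D_D Dn fi.
rewrite (_ : (fun n => _) = fun n => \int[m]_(x in D) (f \_ (D_ n)) x); last first.
  apply/funext => n; rewrite -Rintegral_mkcondr.
  by rewrite setIidr.
apply: (@dominated_Rintegral _ _ _ (fun x => `|f x|)) => //.
- move=> n; apply/(measurable_restrict _ _ _).1 => //.
  apply: measurable_funS; last exact/measurable_EFinP/(measurable_int m fi).
    exact: mD.
  exact: subIsetl.
- move=> x Dx; apply: cvg_near_cst; apply: filterS (Dn x Dx) => n Dnx.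
  by rewrite patchE mem_set.
- exact: integrable_norm.
- by move=> n x Dx; rewrite patchE; case: ifPn => // _; rewrite normr0.
Qed.

End dominated.

(** * Fubini's theorem and integrability criteria *)

Section fubini.
Context d {T : measurableType d} {R : realType} (P : probability T R).
Notation mu := (@lebesgue_measure R).

(** A bound in the second variable alone is enough because [P] has mass 1: by Tonelli the double
    integral of |F| is at most the integral of [G]. *)
Lemma Fubini_dominated (F : T -> R -> R) (G : R -> R) :
  measurable_fun setT (fun z : T * R => F z.1 z.2) ->
  mu.-integrable setT (EFin \o G) ->
  (forall w x, `|F w x| <= G x) ->
  P.-integrable setT (EFin \o (fun w => \int[mu]_x F w x)) /\
  \int[P]_w (\int[mu]_x F w x) = \int[mu]_x (\int[P]_w F w x).
Proof.
move=> mF iG FG.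
have mF2 w : measurable_fun setT (F w).
  exact: (measurable_fun_pair2 w mF).
have mF1 x : measurable_fun setT (F^~ x).
  exact: (measurable_fun_pair1 x mF).
have i2 w : mu.-integrable setT (EFin \o F w).
  apply: le_integrable iG => //; first by apply/measurable_EFinP; exact: mF2.
  move=> x _ /=; rewrite lee_fin (le_trans (FG w x))//; exact: ler_norm.
have i1 x : P.-integrable setT (EFin \o F^~ x).
  apply: (@le_integrable _ _ _ _ _ _ _ (EFin \o cst (G x))) => //.
  - exact/measurable_EFinP.
  - by move=> w _ /=; rewrite lee_fin (le_trans (FG w x))//; exact: ler_norm.
  - exact: finite_measure_integrable_cst.
have imF : (P \x mu)%E.-integrable setT (fun z : T * R => (F z.1 z.2)%:E).
  apply/integrable21ltyP; first exact/measurable_EFinP.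
  apply: (@le_lt_trans _ _ (\int[mu]_x (G x)%:E)%E); last first.
    exact: integrable_lty.
  apply: ge0_le_integral => //=.
  - by move=> x _; apply: integral_ge0.
  - apply: (measurable_fun_fubini_tonelli_G (fun z : T * R => `|(F z.1 z.2)%:E|%E)) => //.
    by apply: measurableT_comp => //; exact/measurable_EFinP.
  - by move: (measurable_int mu iG).
  - move=> x _.
    rewrite (@le_trans _ _ (\int[P]_w (G x)%:E)%E)//.
      apply: ge0_le_integral => //=.
        by apply/measurable_EFinP; apply: measurableT_comp => //; exact: mF1.
      by move=> w _; rewrite lee_fin.
    by rewrite integral_cst//= probability_setT mule1.
split.
  apply: eq_integrable (integrable_fubini_F imF) => // w _.
  by rewrite /= fineK//; exact: (integrable_fin_num _ (i2 w)).
have := Fubini imF.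
rewrite /Rintegral => FF.
congr fine.
rewrite (eq_integral (fun w => (\int[mu]_y (F w y)%:E)%E)); last first.
  by move=> w _; rewrite fineK//; exact: (integrable_fin_num _ (i2 w)).
rewrite FF; apply: eq_integral => x _; rewrite fineK//.
exact: (integrable_fin_num _ (i1 x)).
Qed.

End fubini.

Section integrability.
Context {R : realType}.
Notation mu := (@lebesgue_measure R).

Lemma continuous_at_measurable (D : set (measurableTypeR R)) (f : R -> R) :
  measurable D -> (forall x, D x -> continuous_at x f) -> measurable_fun D f.
Proof.
move=> mD cf; apply: subspace_continuous_measurable_fun => //.
by apply: continuous_in_subspaceT => x; rewrite inE; exact: cf.
Qed.

Lemma bounded_itv_integrable (D : set (measurableTypeR R)) (f : R -> R) (a b M : R) :
  measurable D -> D `<=` `[a, b]%classic -> measurable_fun D f ->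
  (forall x, D x -> `|f x| <= M) -> mu.-integrable D (EFin \o f).
Proof.
move=> mD Dab mf fM.
have iM : mu.-integrable D (EFin \o (fun=> M)).
  by apply: (integrableS _ mD Dab) => //; apply: continuous_integrable; exact: cst_continuous.
apply: (le_integrable mD _ _ iM); first exact/measurable_EFinP.
by move=> x Dx /=; rewrite lee_fin (le_trans (fM x Dx))// ler_norm.
Qed.

Lemma continuous_itv_integrable (f : R -> R) (a b : R) :
  (forall x, a <= x <= b -> continuous_at x f) ->
  mu.-integrable `[a, b] (EFin \o f).
Proof.
move=> cf; apply: continuous_compact_integrable; first exact: segment_compact.
by apply: continuous_in_subspaceT => x; rewrite inE/= in_itv/=; exact: cf.
Qed.

Lemma integrable_expRNnorm (k : R) : 0 < k ->
  mu.-integrable setT (EFin \o fun x => expR (- (k * `|x|))).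
Proof.
move=> k0.
have cf : continuous (fun x : R => expR (- (k * `|x|))).
  move=> x; apply: continuous_at_fexp; apply: continuous_at_fN.
  by apply: continuous_at_fM; [exact: cvg_cst|exact: norm_continuous].
apply/integrableP; split.
  by apply/measurable_EFinP; exact: continuous_measurable_fun.
under eq_integral do rewrite /= ger0_norm ?expR_ge0//.
rewrite ge0_symfun_integralT//; last by move=> x /=; rewrite normrN.
rewrite -set_itvcy.
have -> : (\int[mu]_(x in `[0%R, +oo[) (expR (- (k * `|x|)))%:E =
    \int[mu]_(x in `[0%R, +oo[) (expR (- (k * x)))%:E)%E.
  by apply: eq_integral => x; rewrite inE/= in_itv/= andbT => x0; rewrite ger0_norm.
pose F (x : R) : R := - (k^-1 * expR (- (k * x))).
have dF (x : R) : is_derive x 1 F (expR (- (k * x))).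
  by rewrite /F; derive; field; exact: lt0r_neq0.
rewrite (@ge0_continuous_FTC2y _ (fun x => expR (- (k * x))) F 0 0).
- by rewrite -EFinB -EFinM ltry.
- by move=> x _; exact: expR_ge0.
- by apply: continuous_subspaceT => x; cont.
- rewrite -oppr0 -(mulr0 k^-1); apply: cvgN; apply: cvgM; first exact: cvg_cst.
  under eq_fun do rewrite mulrC.
  apply: (cvg_comp (fun x => x * k) (fun x => expR (- x))); last exact: cvgr_expR.
  by apply: gt0_cvgMly => //; exact: cvg_id.
- by move=> x _; exact: ex_derive.
- by apply: cvg_at_right_filter; exact: (is_derive_cont (dF 0)).
- by move=> x _; rewrite derive1E; exact: derive_val.
Qed.

End integrability.

Lemma normr_sin_le {R : realType} (x : R) : `|sin x| <= `|x|.
Proof.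
wlog : x / 0 < x.
  move=> h; have [/h//|x0|<-] := ltgtP 0 x; last by rewrite sin0 normr0.
  by rewrite -normrN -sinN -(normrN x); apply: h; lra.
move=> x0; have [c _] : exists2 c, c \in `]0, x[%R & sin x - sin 0 = cos c * (x - 0).
  apply: MVT => //.
  by apply: continuous_subspaceT; exact: continuous_sin.
rewrite sin0 !subr0 => ->; rewrite normrM ler_piMl//; exact: cos_max.
Qed.

(** * Deformation of the horizontal line y = pi/2 *)

(* The half-line x <= 0 is pushed from y = pi/2 down to y = 0 and the half-line
   x >= 0 up to y = pi; both limits vanish and only the curve x = 0 remains, on
   which the phase Q is 0.  The -1 that integrates to -pi/2 comes from the end
   x = -oo of the lower half, where exp (P + i Q) tends to 1. *)
Section contour.
Context {R : realType}.
Notation mu := (@lebesgue_measure R).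
Variables (P Q Px Qx : R -> R -> R) (a' : R -> R) (k C : R).
Hypothesis k0 : 0 < k.
Hypothesis dPx : forall x y : R, 0 < y < pi -> is_derive x 1 (P^~ y) (Px x y).
Hypothesis dQx : forall x y : R, 0 < y < pi -> is_derive x 1 (Q^~ y) (Qx x y).
Hypothesis dPy : forall x y : R, 0 < y < pi ->
  is_derive y 1 (P x) (a' y * Px x y - Qx x y).
Hypothesis dQy : forall x y : R, 0 < y < pi ->
  is_derive y 1 (Q x) (a' y * Qx x y + Px x y).
Hypothesis cP : forall x y : R, 0 < y < pi ->
  continuous_at (x, y) (fun z : R * R => P z.1 z.2).
Hypothesis cQ : forall x y : R, 0 < y < pi ->
  continuous_at (x, y) (fun z : R * R => Q z.1 z.2).
Hypothesis cPx : forall x y : R, 0 < y < pi ->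
  continuous_at (x, y) (fun z : R * R => Px z.1 z.2).
Hypothesis cQx : forall x y : R, 0 < y < pi ->
  continuous_at (x, y) (fun z : R * R => Qx z.1 z.2).
Hypothesis ca : forall y : R, 0 < y < pi -> continuous_at y a'.
Hypothesis Q0 : forall y : R, 0 < y < pi -> Q 0 y = 0.
Hypothesis Ple0 : forall x y : R, x <= 0 -> 0 < y <= pi / 2 -> P x y <= 0.
Hypothesis Qle : forall x y : R, x <= 0 -> 0 < y <= pi / 2 ->
  `|Q x y| <= C * sin y * expR (k * x).
Hypothesis P_cvg0 : forall y : R, 0 < y <= pi / 2 ->
  P (- n%:R) y @[n --> \oo] --> 0.
Hypothesis expPle : forall x y : R, 0 <= x -> pi / 2 <= y < pi ->
  expR (P x y) <= C * sin y * expR (- (k * x)).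

Let f x y := expR (P x y) * sin (Q x y).
Let g x y := expR (P x y) * (a' y * sin (Q x y) + cos (Q x y)).

Let pi0 : 0 < pi :> R := pi_gt0 R.

Let cfx y : 0 < y < pi -> continuous (f^~ y).
Proof.
move=> y0 x; rewrite /f; have h1 := dPx x y0; have h2 := dQx x y0.
by cont; apply: is_derive_cont; eassumption.
Qed.

Let cgy x y : 0 < y < pi -> continuous_at y (g x).
Proof.
move=> y0; rewrite /g; have h1 := dPy x y0; have h2 := dQy x y0.
have ca1 := ca y0.
cont => //; try by apply: is_derive_cont; eassumption.
Qed.

Let cP0 y : 0 < y < pi -> continuous_at y (fun y => expR (P 0 y)).
Proof.
move=> y0; have h1 := dPy 0 y0.
by cont; apply: is_derive_cont; eassumption.
Qed.

Let g0 y : 0 < y < pi -> g 0 y = expR (P 0 y).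
Proof. by move=> y0; rewrite /g Q0// sin0 cos0 mulr0 add0r mulr1. Qed.

(** To the left the smallness comes from the phase, |sin Q| <= |Q|; to the right it comes from the
    modulus exp P. In both bounds the factor sin y is what makes the integral over the half-line
    vanish as y tends to 0, respectively pi. *)
Let f_left x y : x <= 0 -> 0 < y <= pi / 2 ->
  `|f x y| <= C * sin y * expR (- (k * `|x|)).
Proof.
move=> x0 y0; rewrite /f normrM (ger0_norm (expR_ge0 _)).
rewrite (@le_trans _ _ (1 * `|Q x y|))//.
  rewrite ler_pM ?expR_ge0//; last exact: normr_sin_le.
  by rewrite -expR0 ler_expR Ple0.
by rewrite mul1r (le_trans (Qle x0 y0))// ler0_norm// mulrN opprK.
Qed.

Let f_right x y : 0 <= x -> pi / 2 <= y < pi ->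
  `|f x y| <= C * sin y * expR (- (k * `|x|)).
Proof.
move=> x0 y0; rewrite /f normrM (ger0_norm (expR_ge0 _)) (ger0_norm x0).
rewrite (le_trans _ (expPle x0 y0))// ler_piMr ?expR_ge0//.
exact: sin_max.
Qed.

Let E (x : R) : R := expR (- (k * `|x|)).
Let iE (D : set (measurableTypeR R)) : measurable D -> mu.-integrable D (EFin \o E).
Proof.
move=> mD; apply: (integrableS measurableT) => //; exact: integrable_expRNnorm.
Qed.

Let iEc (D : set (measurableTypeR R)) c : measurable D ->
  mu.-integrable D (EFin \o (fun x => c * E x)).
Proof.
by move=> mD; exact: (integrableZl mD c (iE mD)).
Qed.

Let f_integrable (D : set (measurableTypeR R)) y c : measurable D -> 0 < y < pi ->
  (forall x, D x -> `|f x y| <= c * E x) -> mu.-integrable D (EFin \o f^~ y).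
Proof.
move=> mD y0 fc.
apply: le_integrable (iEc c mD) => //.
  apply/measurable_EFinP; apply: measurable_funTS.
  by apply: continuous_measurable_fun; exact: cfx.
by move=> x Dx /=; rewrite lee_fin (le_trans (fc x Dx))// ler_norm.
Qed.

Let f_norm_le (D : set (measurableTypeR R)) y : measurable D -> 0 < y < pi ->
  (forall x, D x -> `|f x y| <= C * sin y * E x) ->
  `|\int[mu]_(x in D) f x y| <= sin y * (C * \int[mu]_(x in D) E x).
Proof.
move=> mD y0 fc; have fi := f_integrable mD y0 fc.
apply: le_trans (le_normr_Rintegral mD fi) _.
rewrite mulrA (mulrC _ C) -RintegralZl//; last exact: iE.
apply: le_Rintegral => //; first exact: integrable_norm.
exact: iEc.
Qed.

(** The heights to which the two half-lines are pushed: [yn n] on the left, [pi - yn n] on the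
    right. They start at pi/2, so they stay in the half-strips where the bounds hold. *)
Let yn n : R := pi / 2 / n.+1%:R.
Let yn_gt0 n : 0 < yn n.
Proof. by rewrite /yn !divr_gt0. Qed.
Let yn_le n : yn n <= pi / 2.
Proof. by rewrite /yn ler_pdivrMr// ler_peMr ?ler1n// divr_ge0// ltW. Qed.
Let yn_cvg : yn n @[n --> \oo] --> 0.
Proof.
rewrite /yn -(mulr0 (pi / 2)); apply: cvgM; first exact: cvg_cst.
exact: cvg_harmonic.
Qed.
Let sin_yn_cvg (c : R) : sin (yn n) * c @[n --> \oo] --> 0.
Proof.
rewrite -(mul0r c) -(@sin0 R); apply: cvgM; last exact: cvg_cst.
by apply: cvg_comp; [exact: yn_cvg|exact: continuous_sin].
Qed.

Let contour_xx (x0 x1 y0 y1 : R) : x0 <= x1 -> 0 < y0 -> y0 <= y1 -> y1 < pi ->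
  \int[mu]_(x in `[x0, x1]) f x y1 - \int[mu]_(x in `[x0, x1]) f x y0 =
  \int[mu]_(y in `[y0, y1]) (g x1 y - g x0 y).
Proof.
by move=> x01 y00 y01 y1p; exact: (cauchy_exp x01 y00 y01 y1p dPx dQx dPy dQy).
Qed.

Let a'_bounded (y0 y1 : R) : 0 < y0 -> y1 < pi ->
  exists M : R, forall y, y0 <= y <= y1 -> `|a' y| <= M.
Proof.
move=> y00 y1p; have [|M hM] := @rect_bounded _ (fun _ y => a' y) 0 0 y0 y1.
  move=> x y y01; apply: (@continuous_comp _ _ _ snd a'); first exact: cvg_snd.
  by apply: ca => /=; lra.
by exists M => y y01; apply: (hM 0) => //; rewrite lexx.
Qed.

Let g_bounded (M x y : R) : `|a' y| <= M -> P x y <= 0 -> `|g x y| <= M + 1.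
Proof.
move=> aM Pxy; rewrite /g normrM (ger0_norm (expR_ge0 _)).
rewrite (@le_trans _ _ (1 * (M + 1)))//; last by rewrite mul1r.
rewrite ler_pM ?expR_ge0//; first by rewrite -expR0 ler_expR.
rewrite (le_trans (ler_normD _ _))// lerD ?cos_max// normrM.
by rewrite (le_trans _ aM)// ler_piMr// sin_max.
Qed.

(** Cauchy's theorem on [-n, 0] x [y0, pi/2]. The side x = 0 has zero phase and gives exp (P 0 y);
    on the side x = -n both P and Q tend to 0, so [g] tends to 1. The domination uses that [a'] is
    bounded away from y = 0. *)
Let left_y y0 : 0 < y0 <= pi / 2 ->
  \int[mu]_(x in `]-oo, 0]) f x (pi / 2) - \int[mu]_(x in `]-oo, 0]) f x y0 =
  \int[mu]_(y in `[y0, pi / 2]) (expR (P 0 y) - 1).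
Proof.
move=> /andP[y00 y02].
have lim1 y : 0 < y <= pi / 2 -> \int[mu]_(x in `[- n%:R, 0]) f x y
    @[n --> \oo] --> \int[mu]_(x in `]-oo, 0]) f x y.
  move=> y2; apply: cvg_Rintegral_sets => //.
  - by move=> n x /=; rewrite !in_itv/= => /andP[].
  - move=> x; rewrite /= in_itv/= => x0; near=> n; rewrite in_itv/= x0 andbT.
    rewrite lerNl; near: n; exact: nbhs_infty_ger.
  - apply: (@f_integrable _ y (C * sin y)) => //; first lra.
    by move=> x; rewrite /= in_itv/= => x0; exact: f_left.
have h n : \int[mu]_(x in `[- n%:R, 0]) f x (pi / 2) -
    \int[mu]_(x in `[- n%:R, 0]) f x y0 =
    \int[mu]_(y in `[y0, pi / 2]) (g 0 y - g (- n%:R) y).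
  by apply: contour_xx => //; rewrite ?oppr_le0//; lra.
have p2 : 0 < pi / 2 :> R by rewrite divr_gt0.
have p2p : pi / 2 < pi :> R by lra.
apply: (@cvgn_unique _ (fun n => \int[mu]_(x in `[- n%:R, 0]) f x (pi / 2) -
    \int[mu]_(x in `[- n%:R, 0]) f x y0)).
  by apply: cvgB; apply: lim1; lra.
under eq_fun do rewrite h.
have [M hM] := a'_bounded y00 p2p.
apply: (@dominated_Rintegral _ _ _ _ _ _ _ (fun=> 1 + (M + 1))) => //.
- move=> n; apply: continuous_at_measurable => // y; rewrite /= in_itv/= => y2.
  by apply: continuous_at_fD; [|apply: continuous_at_fN]; apply: cgy; lra.
- move=> y; rewrite /= in_itv/= => y2; rewrite g0; last lra.
  apply: cvgB; first exact: cvg_cst.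
  have Q_cvg : Q (- n%:R) y @[n --> \oo] --> 0.
    apply: (@cvgn_norm0 _ _ (fun n => C * sin y * expR (- (k * n%:R)))).
      by move=> n; rewrite -mulrN; apply: Qle; rewrite ?oppr_le0//; lra.
    rewrite -[X in _ --> X](mulr0 (C * sin y)); apply: cvgM; first exact: cvg_cst.
    exact: cvgn_expRN.
  have -> : nbhs (1 : R) = nbhs (expR 0 * (a' y * sin 0 + cos 0) : R).
    by rewrite expR0 sin0 cos0 mulr0 add0r mulr1.
  rewrite /g; apply: cvgM.
    apply: (cvg_comp _ (@expR R)); last exact: continuous_expR.
    by apply: P_cvg0; lra.
  apply: cvgD; last by apply: (cvg_comp _ (@cos R)) ; [exact: Q_cvg|exact: continuous_cos].
  apply: cvgM; first exact: cvg_cst.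
  by apply: (cvg_comp _ (@sin R)) ; [exact: Q_cvg|exact: continuous_sin].
- by apply: continuous_integrable; exact: cst_continuous.
- move=> n y; rewrite /= in_itv/= => y2; rewrite g0; last lra.
  rewrite (le_trans (ler_normB _ _))// lerD//.
    by rewrite ger0_norm ?expR_ge0// -expR0 ler_expR Ple0//; lra.
  apply: g_bounded; first by apply: hM.
  by apply: Ple0; [rewrite oppr_le0|lra].
Unshelve. all: end_near. Qed.

Let expP_norm_le (M x y : R) : 0 <= x -> pi / 2 <= y < pi -> `|a' y| <= M ->
  `|g x y| <= (C * sin y * (M + 1)) * expR (- (k * x)).
Proof.
move=> x0 y2 aM; rewrite /g normrM (ger0_norm (expR_ge0 _)) mulrAC.
rewrite ler_pM ?expR_ge0//; first exact: expPle.
rewrite (le_trans (ler_normD _ _))// lerD ?cos_max// normrM.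
by rewrite (le_trans _ aM)// ler_piMr// sin_max.
Qed.

(** The bound 1 serves for y <= pi/2, where P <= 0; the bound C serves above pi/2, by the decay
    estimate taken at x = 0. *)
Let expP0_le y : 0 < y < pi -> 0 <= expR (P 0 y) <= Num.max 1 C.
Proof.
move=> y0; rewrite expR_ge0/= le_max; have [y2|y2] := lerP y (pi / 2).
  by rewrite -expR0 ler_expR Ple0//; lra.
apply/orP; right; have := @expPle 0 y (lexx _); rewrite mulr0 oppr0 expR0 mulr1.
have sy : 0 < sin y by apply: sin_gt0_pi; lra.
have s1 := sin_le1 y.
move=> /(_ ltac:(lra)) h; apply: (le_trans h).
have C0 : 0 <= C.
  have := expR_ge0 (P 0 y); move=> /le_trans/(_ h); rewrite pmulr_lge0//.
by rewrite ler_piMr.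
Qed.

Let expP0_integrable (D : set (measurableTypeR R)) : measurable D ->
  D `<=` `]0, pi[%classic -> mu.-integrable D (EFin \o (fun y => expR (P 0 y))).
Proof.
move=> mD D0; apply: (@bounded_itv_integrable _ _ _ 0 pi (Num.max 1 C)) => //.
- by apply: subset_trans D0 _ => y /=; rewrite !in_itv/= => /andP[? ?]; rewrite !ltW.
- by apply: continuous_at_measurable => // y /D0; rewrite /= in_itv; exact: cP0.
- move=> y /D0; rewrite /= in_itv/= => /expP0_le.
  by rewrite ger0_norm ?expR_ge0// => /andP[].
Qed.

(** Cauchy's theorem on [0, n] x [pi/2, y1]. This time the far side x = n vanishes, because exp P
    decays there, and only the side x = 0 remains. *)
Let right_y y1 : pi / 2 <= y1 < pi ->
  \int[mu]_(x in `[0, +oo[) f x (pi / 2) - \int[mu]_(x in `[0, +oo[) f x y1 =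
  \int[mu]_(y in `[pi / 2, y1]) expR (P 0 y).
Proof.
move=> /andP[y12 y1p].
have lim1 y : pi / 2 <= y < pi -> \int[mu]_(x in `[0, n%:R]) f x y
    @[n --> \oo] --> \int[mu]_(x in `[0, +oo[) f x y.
  move=> y2; apply: cvg_Rintegral_sets => //.
  - by move=> n x /=; rewrite !in_itv/= => /andP[->].
  - move=> x; rewrite /= in_itv/= andbT => x0; near=> n; rewrite in_itv/= x0/=.
    near: n; exact: nbhs_infty_ger.
  - apply: (@f_integrable _ y (C * sin y)) => //; first lra.
    by move=> x; rewrite /= in_itv/= andbT => x0; exact: f_right.
have p2 : 0 < pi / 2 :> R by rewrite divr_gt0.
have h n : \int[mu]_(x in `[0, n%:R]) f x (pi / 2) -
    \int[mu]_(x in `[0, n%:R]) f x y1 =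
    \int[mu]_(y in `[pi / 2, y1]) (g 0 y - g n%:R y).
  rewrite -opprB (@contour_xx 0 n%:R (pi / 2) y1)//.
  rewrite -[LHS]mulN1r -RintegralZl//.
    by apply: eq_Rintegral => y _; rewrite mulN1r opprB.
  apply: continuous_itv_integrable => y y2.
  by apply: continuous_at_fD; [|apply: continuous_at_fN]; apply: cgy; lra.
apply: (@cvgn_unique _ (fun n => \int[mu]_(x in `[0, n%:R]) f x (pi / 2) -
    \int[mu]_(x in `[0, n%:R]) f x y1)).
  by apply: cvgB; apply: lim1; lra.
under eq_fun do rewrite h.
have [M hM] := a'_bounded p2 y1p.
have M0 : 0 <= M by rewrite (le_trans (normr_ge0 _) (hM y1 _))// y12/=.
pose G := Num.max 1 C + C * (M + 1).
apply: (@dominated_Rintegral _ _ _ _ _ _ _ (fun=> G)) => //.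
- move=> n; apply: continuous_at_measurable => // y; rewrite /= in_itv/= => y2.
  by apply: continuous_at_fD; [|apply: continuous_at_fN]; apply: cgy; lra.
- move=> y; rewrite /= in_itv/= => y2; rewrite g0; last lra.
  rewrite -[X in _ --> X]subr0; apply: cvgB; first exact: cvg_cst.
  apply: (@cvgn_norm0 _ _ (fun n => (C * sin y * (M + 1)) * expR (- (k * n%:R)))).
    by move=> n; apply: expP_norm_le => //; [lra|exact: hM].
  rewrite -[X in _ --> X](mulr0 (C * sin y * (M + 1))); apply: cvgM; first exact: cvg_cst.
  exact: cvgn_expRN.
- by apply: continuous_integrable; exact: cst_continuous.
- move=> n y; rewrite /= in_itv/= => y2; rewrite g0; last lra.
  rewrite (le_trans (ler_normB _ _))// /G lerD//.
    have /andP[_ +] : 0 <= expR (P 0 y) <= Num.max 1 C by apply: expP0_le; lra.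
    by rewrite ger0_norm ?expR_ge0.
  have y2' : pi / 2 <= y < pi by lra.
  have C0 : 0 <= C.
    have := le_trans (expR_ge0 _) (@expPle 0 y (lexx _) y2').
    by rewrite mulr0 oppr0 expR0 mulr1 pmulr_lge0//; apply: sin_gt0_pi; lra.
  apply: (le_trans (expP_norm_le _ y2' (hM y y2))) => //.
  have s0 : 0 < sin y by apply: sin_gt0_pi; lra.
  have s1 := sin_le1 y.
  rewrite -[leRHS]mulr1 ler_pM ?expR_ge0//.
  + by rewrite !mulr_ge0//; lra.
  + by rewrite ler_wpM2r//; [lra|rewrite ler_piMr].
  + by rewrite -[leRHS]expR0 ler_expR oppr_le0 mulr_ge0// ltW.
Unshelve. all: end_near. Qed.

(** The lower line disappears as its height [yn n] tends to 0, by the factor sin (yn n), while the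
    intervals [yn n, pi/2] exhaust ]0, pi/2]. *)
Let left_side :
  \int[mu]_(x in `]-oo, 0]) f x (pi / 2) =
  \int[mu]_(y in `]0, (pi / 2)]) (expR (P 0 y) - 1).
Proof.
have p2 : 0 < pi / 2 :> R by rewrite divr_gt0.
have iP (D : set (measurableTypeR R)) : measurable D -> D `<=` `]0, (pi / 2)]%classic ->
    mu.-integrable D (EFin \o (fun y => expR (P 0 y) - 1)).
  move=> mD D2; apply: (@bounded_itv_integrable _ _ _ 0 pi 1) => //.
  - apply: subset_trans D2 _ => y /=; rewrite !in_itv/= => /andP[? ?].
    by apply/andP; split; lra.
  - apply: continuous_at_measurable => // y /D2; rewrite /= in_itv/= => y2.
    by apply: continuous_at_fD; [apply: cP0; lra|exact: cvg_cst].
  - move=> y /D2; rewrite /= in_itv/= => y2.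
    have e1 : expR (P 0 y) <= 1 by rewrite -expR0 ler_expR Ple0.
    by have := expR_ge0 (P 0 y); rewrite ler_norml; lra.
apply: (@cvgn_unique _ (fun n => \int[mu]_(x in `]-oo, 0]) f x (pi / 2) -
    \int[mu]_(x in `]-oo, 0]) f x (yn n))).
  rewrite -[X in _ --> X]subr0; apply: cvgB; first exact: cvg_cst.
  apply: (@cvgn_norm0 _ _ (fun n => sin (yn n) * (C * \int[mu]_(x in `]-oo, 0]) E x))).
    move=> n; have y0 := yn_gt0 n; have y2 := yn_le n.
    apply: f_norm_le => //; first lra.
    by move=> x; rewrite /= in_itv/= => x0; apply: f_left => //; lra.
  exact: sin_yn_cvg.
have h n : \int[mu]_(x in `]-oo, 0]) f x (pi / 2) -
    \int[mu]_(x in `]-oo, 0]) f x (yn n) =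
    \int[mu]_(y in `[yn n, (pi / 2)]) (expR (P 0 y) - 1).
  by apply: left_y; rewrite yn_gt0 yn_le.
under eq_fun do rewrite h.
apply: cvg_Rintegral_sets => //.
- move=> n y; rewrite /= !in_itv/= => /andP[+ ->]; rewrite andbT.
  by apply: lt_le_trans; exact: yn_gt0.
- move=> y; rewrite /= in_itv/= => /andP[y0 y2]; near=> n; rewrite in_itv/= y2 andbT ltW//.
  by near: n; apply: (cvgr_lt (0 : R)) => //; exact: yn_cvg.
- exact: iP.
Unshelve. all: end_near. Qed.

Let right_side :
  \int[mu]_(x in `[0, +oo[) f x (pi / 2) =
  \int[mu]_(y in `[(pi / 2), pi[) expR (P 0 y).
Proof.
have p2 : 0 < pi / 2 :> R by rewrite divr_gt0.
apply: (@cvgn_unique _ (fun n => \int[mu]_(x in `[0, +oo[) f x (pi / 2) -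
    \int[mu]_(x in `[0, +oo[) f x (pi - yn n))).
  rewrite -[X in _ --> X]subr0; apply: cvgB; first exact: cvg_cst.
  apply: (@cvgn_norm0 _ _ (fun n => sin (yn n) * (C * \int[mu]_(x in `[0, +oo[) E x))).
    move=> n; have y0 := yn_gt0 n; have y2 := yn_le n.
    rewrite (_ : sin (yn n) = sin (pi - yn n)); last by rewrite sinB sinpi cospi; ring.
    apply: f_norm_le => //; first lra.
    by move=> x; rewrite /= in_itv/= andbT => x0; apply: f_right => //; lra.
  exact: sin_yn_cvg.
have h n : \int[mu]_(x in `[0, +oo[) f x (pi / 2) -
    \int[mu]_(x in `[0, +oo[) f x (pi - yn n) =
    \int[mu]_(y in `[(pi / 2), (pi - yn n)]) expR (P 0 y).
  by apply: right_y; have y0 := yn_gt0 n; have y2 := yn_le n; lra.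
under eq_fun do rewrite h.
apply: cvg_Rintegral_sets => //.
- move=> n y; rewrite /= !in_itv/= => /andP[-> yn1]/=.
  by have y0 := yn_gt0 n; lra.
- move=> y; rewrite /= in_itv/= => /andP[y2 yp]; near=> n; rewrite in_itv/= y2/=.
  have : yn n < pi - y.
    by near: n; apply: (cvgr_lt (0 : R)); [exact: yn_cvg|lra].
  lra.
- by apply: expP0_integrable => // y /=; rewrite !in_itv/=; lra.
Unshelve. all: end_near. Qed.

Lemma contour_integrable :
  mu.-integrable setT (EFin \o (fun x => expR (P x (pi / 2)) * sin (Q x (pi / 2)))).
Proof.
have p0 := pi0.
apply: (@f_integrable _ (pi / 2) (C * sin (pi / 2))) => //; first lra.
by move=> x _; have [x0|x0] := lerP 0 x; [apply: f_right|apply: f_left] => //; lra.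
Qed.

Lemma contour_integral :
  \int[mu]_x (expR (P x (pi / 2)) * sin (Q x (pi / 2))) =
  \int[mu]_(y in `]0, pi[) expR (P 0 y) - pi / 2.
Proof.
have p2 : 0 < pi / 2 :> R by rewrite divr_gt0.
have fi := contour_integrable.
rewrite -[LHS]/(\int[mu]_x f x (pi / 2)).
have -> : \int[mu]_x f x (pi / 2) = \int[mu]_(x in `]-oo, 0]) f x (pi / 2) +
    \int[mu]_(x in `[0, +oo[) f x (pi / 2).
  rewrite -Rintegral_itv_obnd_cbnd; last exact: (integrableS measurableT).
  rewrite -Rintegral_setU//.
  - by congr (Rintegral _ _ _); rewrite -itv_bndbnd_setU ?set_itvNyy.
  - by apply: (integrableS measurableT _ _ fi) => //; exact: measurableU.
  - by apply/disj_setPS => x [/=]; rewrite !in_itv/= andbT; lra.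
have sub1 : `]0, (pi / 2)]%classic `<=` (`]0, pi[%classic : set R).
  by move=> y /=; rewrite !in_itv/=; lra.
have sub2 : `](pi / 2), pi[%classic `<=` (`]0, pi[%classic : set R).
  by move=> y /=; rewrite !in_itv/=; lra.
have splitE : (`]0, pi[%classic : set R) = `]0, (pi / 2)]%classic `|` `](pi / 2), pi[%classic.
  by rewrite -itv_bndbnd_setU// bnd_simp; lra.
rewrite left_side right_side RintegralB//; last 2 first.
- exact: expP0_integrable.
- apply: (@integrableS _ _ _ mu `[0, pi / 2]) => //.
    by move=> y /=; rewrite !in_itv/= => /andP[? ->]; rewrite ltW.
  by apply: continuous_integrable; exact: cst_continuous.
rewrite splitE Rintegral_setU//; last 2 first.
- by rewrite -splitE; exact: expP0_integrable.
- by apply/disj_setPS => x [/=]; rewrite !in_itv/=; lra.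
rewrite (@Rintegral_itv_obnd_cbnd _ (pi / 2)); last exact: expP0_integrable.
rewrite Rintegral_cst//.
have -> : fine (mu `]0, (pi / 2)]) = pi / 2.
  have := @lebesgue_measure_itv R `]0, (pi / 2)].
  by rewrite /= lte_fin p2 oppr0 adde0 => ->.
by rewrite mul1r addrAC.
Qed.

End contour.

(** * Gil-Pelaez inversion and medians *)

Section regularized_dirichlet.
Context {R : realType}.
Notation mu := (@lebesgue_measure R).

Lemma normr_sinB_le (x y : R) : `|sin x - sin y| <= `|x - y|.
Proof.
wlog xy : x y / y < x.
  move=> h; have [/h//|xy|->] := ltgtP y x; last by rewrite !subrr.
  by rewrite distrC (distrC x); exact: h.
have [c _] : exists2 c, c \in `]y, x[%R & sin x - sin y = cos c * (x - y).
  by apply: MVT => //; apply: continuous_subspaceT; exact: continuous_sin.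
by move=> ->; rewrite normrM ler_piMl//; exact: cos_max.
Qed.

Lemma expRN_le_sqr (x : R) : 0 < x -> expR (- x) <= 2 / x ^+ 2.
Proof.
move=> x0; rewrite expRN ler_pdivlMr ?exprn_gt0// mulrC ler_pdivrMr ?expR_gt0//.
have := @expR_ge1Dxn _ x 1 (ltW x0).
rewrite (_ : 2`!%:R = 2 :> R)// => h.
have : x ^+ 2 / 2 <= expR x by apply: le_trans h; rewrite lerDr.
by rewrite ler_pdivrMr// mulrC.
Qed.

Variable e : R.
Hypothesis e0 : 0 < e.

(** In the variable l = e^b, [G b] db is exp (- e l) dl. *)
Let G (b : R) := expR b * expR (- (e * expR b)).

Lemma integrable_expR_expRN : mu.-integrable setT (EFin \o G).
Proof.
have cG : continuous G.
  by move=> b; rewrite /G; cont.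
(* The summand 1 serves for b < 0, where the second factor of [G] is at most 1; the summand 2 / e^2
   serves for b >= 0, by [expRN_le_sqr] at e * expR b. *)
have iK : mu.-integrable setT (EFin \o (fun b => (1 + 2 / e ^+ 2) * expR (- (1 * `|b|)))).
  exact: (integrableZl measurableT (1 + 2 / e ^+ 2) (integrable_expRNnorm ltr01)).
apply: (le_integrable measurableT _ _ iK).
  by apply/measurable_EFinP; exact: continuous_measurable_fun.
move=> b _ /=; rewrite lee_fin mul1r.
have K0 : 0 < 2 / e ^+ 2 by rewrite divr_gt0// exprn_gt0.
rewrite ger0_norm ?mulr_ge0 ?expR_ge0// ger0_norm ?mulr_ge0 ?expR_ge0 ?addr_ge0 ?(ltW K0)//.
have [b0|b0] := lerP 0 b; last first.
  rewrite ltr0_norm// /G opprK mulrC ler_pM ?expR_ge0//.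
  rewrite (@le_trans _ _ 1)//; last by rewrite lerDl ltW.
  by rewrite -expR0 ler_expR oppr_le0 mulr_ge0 ?expR_ge0 ?ltW.
rewrite (ger0_norm b0).
have eb : 0 < e * expR b by rewrite mulr_gt0// expR_gt0.
rewrite (@le_trans _ _ (2 / e ^+ 2 * expR (- b)))//; last first.
  by rewrite ler_pM2r ?expR_gt0// lerDr.
rewrite /G (@le_trans _ _ (expR b * (2 / (e * expR b) ^+ 2)))//.
  by rewrite ler_pM2l ?expR_gt0//; exact: expRN_le_sqr.
rewrite expRN le_eqVlt; apply/orP; left; apply/eqP.
by field; rewrite expR_eq0 lt0r_neq0.
Qed.

Let integrable_G_le (f : R -> R) (c : R) : continuous f ->
  (forall b, `|f b| <= c * G b) -> mu.-integrable setT (EFin \o f).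
Proof.
move=> cf fG.
have iK : mu.-integrable setT (EFin \o (fun b => c * G b)).
  exact: (integrableZl measurableT c integrable_expR_expRN).
apply: (le_integrable measurableT _ _ iK).
  by apply/measurable_EFinP; exact: continuous_measurable_fun.
by move=> b _ /=; rewrite lee_fin (le_trans (fG b))// ler_norm.
Qed.

Let G0 b : 0 <= G b. Proof. by rewrite mulr_ge0 ?expR_ge0. Qed.

Lemma integral_cos_kernel (t : R) :
  \int[mu]_b (G b * cos (expR b * t)) = e / (e ^+ 2 + t ^+ 2).
Proof.
have et0 : e ^+ 2 + t ^+ 2 != 0.
  by rewrite lt0r_neq0// ltr_pwDl ?exprn_gt0// sqr_ge0.
(* The primitive of exp (- e l) cos (l t) in l; it vanishes at infinity and is - e / (e^2 + t^2) at
   l = 0. *)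
pose F (l : R) := expR (- (e * l)) * (t * sin (l * t) - e * cos (l * t)) / (e ^+ 2 + t ^+ 2).
have dF (b : R) : is_derive b 1 (fun b => F (expR b)) (G b * cos (expR b * t)).
  by rewrite /F /G; derive; field.
have cf : continuous (fun b => G b * cos (expR b * t)).
  by move=> b; rewrite /G; cont.
have fi : mu.-integrable setT (EFin \o (fun b => G b * cos (expR b * t))).
  apply: (@integrable_G_le _ 1) => // b.
  by rewrite normrM ger0_norm// mul1r ler_piMr// cos_max.
apply: (@cvgn_unique _ (fun n => \int[mu]_(b in `[- n%:R, n%:R]) (G b * cos (expR b * t)))).
  apply: cvg_Rintegral_sets => // b _; near=> n.
  rewrite /= in_itv/= -ler_norml; near: n; exact: nbhs_infty_ger.
have h n : \int[mu]_(b in `[- n%:R, n%:R]) (G b * cos (expR b * t)) =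
    F (expR n%:R) - F (expR (- n%:R)).
  notypeclasses refine (FTC_Rintegral (F := fun b => F (expR b)) _ _ _) => //.
  by rewrite lerNl (le_trans (_ : _ <= 0))// oppr_le0.
under eq_fun do rewrite h.
rewrite (_ : e / _ = 0 - F 0); last first.
  by rewrite /F !mul0r sin0 cos0 mulr0 oppr0 expR0; field.
apply: cvgB.
  apply: (@cvgn_norm0 _ _ (fun n => expR (- (e * n%:R)) * ((`|t| + e) / (e ^+ 2 + t ^+ 2)))).
    move=> n; rewrite /F -mulrA normrM ger0_norm ?expR_ge0// ler_pM ?expR_ge0//.
      rewrite ler_expR lerN2 ler_pM2l// (le_trans _ (expR_ge1Dx _))//.
      by rewrite lerDr.
    rewrite normrM [X in _ * X]ger0_norm; last first.
      by rewrite invr_ge0 addr_ge0 ?sqr_ge0.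
    rewrite ler_wpM2r ?invr_ge0 ?addr_ge0 ?sqr_ge0//.
    rewrite (le_trans (ler_normB _ _))// lerD// normrM.
      by rewrite ler_piMr// sin_max.
    by rewrite (gtr0_norm e0) ler_piMr ?(ltW e0)// cos_max.
  rewrite -(mul0r ((`|t| + e) / (e ^+ 2 + t ^+ 2))); apply: cvgM; last exact: cvg_cst.
  exact: cvgn_expRN.
have cF : continuous_at (0 : R) F by rewrite /F; cont.
exact: (cvg_comp _ _ (@cvgn_expR R) cF).
Unshelve. all: end_near. Qed.

(** The factor e^b that [G] has in addition is recovered from |sin (e^b t)| <= e^b |t|. *)
Lemma integrable_sin_kernel (t : R) :
  mu.-integrable setT (EFin \o (fun b => expR (- (e * expR b)) * sin (expR b * t))).
Proof.
apply: (@integrable_G_le _ `|t|) => [b|b]; first by cont.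
rewrite /G normrM ger0_norm ?expR_ge0// mulrC mulrA ler_pM2r ?expR_gt0//.
by rewrite (le_trans (normr_sin_le _))// normrM ger0_norm ?expR_ge0// mulrC.
Qed.

(** In the variable l this is the integral of exp (- e l) sin (l t) / l over l > 0. Both sides
    vanish at t = 0, and their t-derivatives agree by [integral_cos_kernel]. *)
Lemma integral_sin_kernel (t : R) :
  \int[mu]_b (expR (- (e * expR b)) * sin (expR b * t)) = atan (t / e).
Proof.
pose f (t b : R) := expR (- (e * expR b)) * sin (expR b * t).
pose Phi t := \int[mu]_b f t b.
have fi t' : mu.-integrable setT (EFin \o f t') by exact: integrable_sin_kernel.
have df (t' b : R) : is_derive t' 1 (f^~ b) (G b * cos (expR b * t')).
  by rewrite /f /G; derive_ring.
have dPhi (t' : R) : is_derive t' 1 Phi (e / (e ^+ 2 + t' ^+ 2)).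
  have It : `]t' - 1, t' + 1[%classic t' by rewrite /= in_itv/=; lra.
  have bd x y : `]t' - 1, t' + 1[%classic x -> [set: R] y -> `|partial1of2 f x y| <= G y.
    move=> _ _; rewrite partial1of2E (@derive_val _ _ _ _ _ _ _ (df x y)).
    by rewrite normrM ger0_norm// ler_piMr// cos_max.
  have ex x y : `]t' - 1, t' + 1[%classic x -> [set: R] y -> derivable (f^~ y) x 1.
    by move=> _ _; exact: (@ex_derive _ _ _ _ _ _ _ (df x y)).
  apply: DeriveDef.
    exact: (derivable_under_integral _ It (fun x _ => fi x) ex G0 integrable_expR_expRN bd).
  rewrite -integral_cos_kernel -derive1E.
  rewrite (differentiation_under_integral _ It (fun x _ => fi x) ex G0 integrable_expR_expRN bd)//.
  by apply: eq_Rintegral => b _; rewrite partial1of2E (@derive_val _ _ _ _ _ _ _ (df t' b)).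
have dD (t' : R) : is_derive t' 1 (fun t => Phi t - atan (t / e)) 0.
  have h1 := dPhi t'.
  have h2 : is_derive t' 1 (fun t => atan (t / e)) ((1 + (t' / e) ^+ 2)^-1 * e^-1).
    have h3 : is_derive t' 1 (fun t : R => t / e) e^-1 by derive_ring.
    exact: (@is_derive1_comp _ (@atan R) _ _ _ _ (is_derive1_atan _) h3).
  derive; field; rewrite ?lt0r_neq0//.
  by rewrite ltr_pwDl ?exprn_gt0// sqr_ge0.
have := is_derive_0_is_cst.
have P0 : Phi 0 = 0.
  rewrite /Phi (_ : (fun b => _) = cst 0).
    by rewrite /Rintegral integral0.
  by apply/funext => b; rewrite /f mulr0 sin0 mulr0.
move=> /(_ _ _ 0 t dD)/=; rewrite P0 mul0r atan0 subrr => /esym/eqP.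
by rewrite subr_eq0 => /eqP.
Qed.

End regularized_dirichlet.

Section gil_pelaez.
Context d {T : measurableType d} {R : realType} (P : probability T R).
Notation mu := (@lebesgue_measure R).

Lemma measurable_fsin d' (U : measurableType d') (f : U -> R) :
  measurable_fun setT f -> measurable_fun setT (fun u => sin (f u)).
Proof.
move=> mf; apply: (measurableT_comp _ mf).
by apply: continuous_measurable_fun; exact: continuous_sin.
Qed.

Lemma measurable_fexp d' (U : measurableType d') (f : U -> R) :
  measurable_fun setT f -> measurable_fun setT (fun u => expR (f u)).
Proof. by move=> mf; exact: (measurableT_comp (@measurable_expR R) mf). Qed.

Lemma cvgn_atan_sg (t : R) : atan (t / n.+1%:R^-1) @[n --> \oo] --> pi / 2 * Num.sg t.
Proof.
have pos (s : R) : 0 < s -> atan (s / n.+1%:R^-1) @[n --> \oo] --> pi / 2.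
  move=> s0; under eq_fun do rewrite invrK.
  apply: (cvg_comp (fun n => n.+1%:R) (fun x => atan (s * x))).
    exact: (cvg_comp _ _ (cvg_addnl 1) cvgr_idn).
  under eq_fun do rewrite mulrC.
  apply: (cvg_comp (fun x => x * s) atan _ (@cvgy_atan R)).
  by apply: gt0_cvgMly => //; exact: cvg_id.
have [t0|t0|<-] := ltgtP 0 t.
- by rewrite gtr0_sg// mulr1; exact: pos.
- rewrite ltr0_sg// mulrN1.
  have /pos h : 0 < - t by lra.
  rewrite (_ : (fun n => _) = (fun n => - atan (- t / n.+1%:R^-1))); last first.
    by apply/funext => n; rewrite mulNr atanN opprK.
  exact: cvgN.
- by rewrite sgr0 mulr0; under eq_fun do rewrite mul0r atan0; exact: cvg_cst.
Qed.

Lemma measurable_sg d' (U : measurableType d') (f : U -> R) :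
  measurable_fun setT f -> measurable_fun setT (fun u => Num.sg (f u)).
Proof.
move=> mf; apply: (measurableT_comp _ mf).
apply: nondecreasing_measurable => // x y xy.
have [x0|x0|x0] := ltgtP x 0; have [y0|y0|y0] := ltgtP y 0;
  rewrite ?x0 ?y0 ?sgr0 ?(gtr0_sg x0) ?(ltr0_sg x0) ?(gtr0_sg y0) ?(ltr0_sg y0); lra.
Qed.

Lemma measurable_fatan d' (U : measurableType d') (f : U -> R) :
  measurable_fun setT f -> measurable_fun setT (fun u => atan (f u)).
Proof.
move=> mf; apply: (measurableT_comp _ mf).
by apply: continuous_measurable_fun => x; exact: continuous_atan.
Qed.

Lemma normr_sgB_le (x y : R) : `|Num.sg x - Num.sg y| <= 2.
Proof.
rewrite (le_trans (ler_normB _ _))// !normr_sg.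
by case: eqP => _; case: eqP => _ /=; lra.
Qed.

Lemma integrable_sgB (Y : {RV P >-> R}) (y1 y2 : R) :
  P.-integrable setT (EFin \o (fun w => Num.sg (Y w - y1) - Num.sg (Y w - y2))).
Proof.
apply: (@le_integrable _ _ _ _ _ _ _ (EFin \o cst 2)) => //.
- apply/measurable_EFinP; apply: measurable_funB; apply: measurable_sg;
    exact: measurable_funB.
- by move=> w _ /=; rewrite lee_fin (ger0_norm (ler0n _ 2)) normr_sgB_le.
- exact: finite_measure_integrable_cst.
Qed.

(* The factor exp (- e l), with l = e^b, makes Fubini applicable; e tends to 0. *)
Lemma gil_pelaez (Y : {RV P >-> R}) (S : R -> R -> R) (y1 y2 : R) :
  (forall b y, \int[P]_w sin (expR b * (Y w - y)) = S b y) ->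
  mu.-integrable setT (EFin \o S^~ y1) -> mu.-integrable setT (EFin \o S^~ y2) ->
  \int[mu]_b S b y1 - \int[mu]_b S b y2 =
  pi / 2 * \int[P]_w (Num.sg (Y w - y1) - Num.sg (Y w - y2)).
Proof.
move=> hS i1 i2.
have mY : measurable_fun setT Y by [].
(* The difference of the two sines is at most |y2 - y1| e^b uniformly in w, whatever the tails of
   [Y]. This is why two points y1, y2 are compared instead of treating one. *)
pose f (e : R) w b := expR (- (e * expR b)) *
  (sin (expR b * (Y w - y1)) - sin (expR b * (Y w - y2))).
have sin_i b y : P.-integrable setT (EFin \o (fun w => sin (expR b * (Y w - y)))).
  apply: (@le_integrable _ _ _ _ _ _ _ (EFin \o cst 1)) => //.
  - apply/measurable_EFinP; apply: measurable_fsin.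
    by apply: measurable_funM => //; exact: measurable_funB.
  - by move=> w _ /=; rewrite lee_fin normr1; exact: sin_max.
  - exact: finite_measure_integrable_cst.
have fubini e : 0 < e -> \int[P]_w (atan ((Y w - y1) / e) - atan ((Y w - y2) / e)) =
    \int[mu]_b (expR (- (e * expR b)) * (S b y1 - S b y2)).
  move=> e0.
  transitivity (\int[P]_w (\int[mu]_b f e w b)).
    apply: eq_Rintegral => w _; rewrite -!integral_sin_kernel// -RintegralB//.
    - by apply: eq_Rintegral => b _; rewrite /f [RHS]mulrBr.
    - exact: integrable_sin_kernel.
    - exact: integrable_sin_kernel.
  have [|||_ ->] := @Fubini_dominated _ _ _ P (f e)
    (fun b => `|y2 - y1| * (expR b * expR (- (e * expR b)))).
  - rewrite /f/=; apply: measurable_funM.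
      apply: measurable_fexp; apply: measurable_funN; apply: measurable_funM => //.
      by apply: measurable_fexp; exact: measurable_snd.
    apply: measurable_funB; apply: measurable_fsin; apply: measurable_funM.
    + by apply: measurable_fexp; exact: measurable_snd.
    + by apply: measurable_funB => //; exact: (measurableT_comp mY measurable_fst).
    + by apply: measurable_fexp; exact: measurable_snd.
    + by apply: measurable_funB => //; exact: (measurableT_comp mY measurable_fst).
  - exact: (integrableZl measurableT _ (integrable_expR_expRN e0)).
  - move=> w b; rewrite /f normrM ger0_norm ?expR_ge0// mulrC mulrA ler_pM2r ?expR_gt0//.
    rewrite (le_trans (normr_sinB_le _ _))// -mulrBr normrM ger0_norm ?expR_ge0// mulrC.
    by rewrite (_ : Y w - y1 - (Y w - y2) = y2 - y1)//; lra.
  - apply: eq_Rintegral => b _; rewrite /f RintegralZl//.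
      by rewrite RintegralB// !hS.
    exact: (integrableB measurableT (sin_i b y1) (sin_i b y2)).
have en0 n : 0 < n.+1%:R^-1 :> R by [].
(* Limit of both sides of [fubini] at e = 1/(n+1): the integral in b is dominated by |S b y1 - S b
   y2|, the expectation of the arctangents by pi. *)
apply: (@cvgn_unique _ (fun n => \int[mu]_b (expR (- (n.+1%:R^-1 * expR b)) * (S b y1 - S b y2)))).
  rewrite -RintegralB//.
  apply: (@dominated_Rintegral _ _ _ mu setT
    (fun n b => expR (- (n.+1%:R^-1 * expR b)) * (S b y1 - S b y2))
    (fun b => S b y1 - S b y2) (fun b => `|S b y1 - S b y2|)) => //.
  - move=> n; apply: measurable_funM.
      apply: measurable_fexp; apply: measurable_funN; apply: measurable_funM => //.
    by apply/measurable_EFinP; exact: (measurable_int mu (integrableB measurableT i1 i2)).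
  - move=> b _; rewrite -[X in _ --> X]mul1r; apply: cvgM; last exact: cvg_cst.
    have h : n.+1%:R^-1 * expR b @[n --> \oo] --> 0 * expR b.
      by apply: cvgM; [exact: cvg_harmonic|exact: cvg_cst].
    have -> : nbhs (1 : R) = nbhs (expR (- (0 * expR b))) by rewrite mul0r oppr0 expR0.
    apply: (cvg_comp _ (@expR R)); last exact: continuous_expR.
    exact: cvgN.
  - exact: (integrable_norm (integrableB measurableT i1 i2)).
  - move=> n b _; rewrite normrM ler_piMl// ger0_norm ?expR_ge0//.
under eq_fun do rewrite -fubini//.
rewrite -RintegralZl//; last exact: integrable_sgB.
apply: (@dominated_Rintegral _ _ _ P setT
  (fun n w => atan ((Y w - y1) / n.+1%:R^-1) - atan ((Y w - y2) / n.+1%:R^-1))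
  (fun w => pi / 2 * (Num.sg (Y w - y1) - Num.sg (Y w - y2))) (fun w => pi)) => //.
- move=> n; apply: measurable_funB; apply: measurable_fatan; apply: measurable_funM => //;
    exact: measurable_funB.
- move=> w _; rewrite mulrBr; apply: cvgB; exact: cvgn_atan_sg.
- exact: finite_measure_integrable_cst.
- move=> n w _; rewrite (le_trans (ler_normB _ _))//.
  rewrite [leRHS](splitr pi) lerD// ler_norml !ltW//; by [exact: atan_ltpi2|exact: atan_gtNpi2].
Qed.

End gil_pelaez.

(** * The equation satisfied by a median *)

Section median_equation.
Context d {T : measurableType d} {R : realType} (P : probability T R).
Notation mu := (@lebesgue_measure R).

Lemma Rintegral_indic (A : set T) : measurable A ->
  \int[P]_w (\1_A w : R) = fine (P A).
Proof. by move=> mA; rewrite /Rintegral integral_indic// setIT. Qed.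

(** 1 - sg (Y - m) is the sum of the indicators of Y <= m and of Y < m. The second event is the
    complement of m <= Y, so each has probability 1/2. *)
Lemma median_sg (Y : {RV P >-> R}) (m : R) : is_median P Y m ->
  \int[P]_w (1 - Num.sg (Y w - m)) = 1.
Proof.
move=> [hle hge].
have mle : measurable [set w | Y w <= m].
  rewrite (_ : [set w | _] = Y @^-1` `]-oo, m]%classic); first exact: measurable_funPTI.
  by apply/seteqP; split => w /=; rewrite in_itv.
have mlt : measurable [set w | Y w < m].
  rewrite (_ : [set w | _] = Y @^-1` `]-oo, m[%classic); first exact: measurable_funPTI.
  by apply/seteqP; split => w /=; rewrite in_itv.
have hlt : P [set w | Y w < m] = (2^-1)%:E.
  rewrite (_ : [set w | _] = ~` [set w | m <= Y w]); last first.
    by apply/seteqP; split => w /=; rewrite ltNge => /negP.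
  have mge : measurable [set w | m <= Y w].
    rewrite (_ : [set w | _] = Y @^-1` `[m, +oo[%classic); first exact: measurable_funPTI.
    by apply/seteqP; split => w /=; rewrite in_itv/= andbT.
  by rewrite probability_setC// hge -EFinB; congr EFin; lra.
have ii (A : set T) : measurable A -> P.-integrable setT (EFin \o \1_A).
  by move=> mA; apply: integrable_indic.
transitivity (\int[P]_w (\1_[set w | Y w <= m] w + \1_[set w | Y w < m] w : R)).
  apply: eq_Rintegral => w _; rewrite !indicE.
  have [h|h|h] := ltgtP (Y w) m.
  - by rewrite !mem_set//= ?ltW// ltr0_sg ?subr_lt0// opprK.
  - have h1 : ~ [set w | Y w <= m] w by apply/negP; rewrite -ltNge.
    have h2 : ~ [set w | Y w < m] w by apply/negP; rewrite -leNgt ltW.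
    by rewrite !memNset//= gtr0_sg ?subr_gt0// subrr addr0.
  - have h2 : ~ [set w | Y w < m] w by rewrite /= h ltxx.
    by rewrite mem_set/= ?h// memNset// subrr sgr0 subr0 addr0.
rewrite RintegralD//; try exact: ii.
by rewrite !Rintegral_indic// hle hlt /=; lra.
Qed.

(* Compares [m] with [m - n], for which [sg (Y - (m - n))] tends to 1. *)
Lemma median_equation (Y : {RV P >-> R}) (S : R -> R -> R) (kap B : R -> R) (m : R) :
  (forall b y, \int[P]_w sin (expR b * (Y w - y)) = S b y) ->
  (forall y, y <= m -> mu.-integrable setT (EFin \o S^~ y)) ->
  (forall y, y <= m -> \int[mu]_b S b y =
    \int[mu]_(u in `]0, pi[) expR (- (kap y * B u)) - pi / 2) ->
  (forall y, y <= m -> 0 <= kap y) ->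
  kap (m - n%:R) @[n --> \oo] --> 0 ->
  measurable_fun `]0, pi[ B -> (forall u, 0 < u < pi -> 0 <= B u) ->
  is_median P Y m ->
  \int[mu]_(u in `]0, pi[) expR (- (kap m * B u)) = pi / 2.
Proof.
move=> hS iS IS kap0 kapc mB B0 med.
have mn n : m - n%:R <= m by rewrite gerBl.
have gp n := gil_pelaez hS (iS _ (mn n)) (iS _ (lexx m)).
have h1 : \int[mu]_b S b (m - n%:R) - \int[mu]_b S b m @[n --> \oo] -->
    (pi - pi / 2) - \int[mu]_b S b m.
  apply: cvgB; last exact: cvg_cst.
  under eq_fun do rewrite IS//.
  apply: cvgB; last exact: cvg_cst.
  have -> : nbhs (pi : R) = nbhs (\int[mu]_(u in `]0, pi[) (fun=> 1 : R) u).
    rewrite Rintegral_cst//.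
    have := @lebesgue_measure_itv R `]0, pi[.
    by rewrite /= lte_fin pi_gt0 oppr0 adde0 => -> /=; rewrite mul1r.
  apply: (@dominated_Rintegral _ _ _ mu `]0, pi[
    (fun n u => expR (- (kap (m - n%:R) * B u))) (fun=> 1) (fun=> 1)) => //.
  - move=> n; apply: (measurableT_comp (@measurable_expR R)).
    by apply: measurable_funN; apply: measurable_funM.
  - move=> u _; have -> : nbhs (1 : R) = nbhs (expR (- (0 * B u))).
      by rewrite mul0r oppr0 expR0.
    apply: (cvg_comp _ (@expR R)); last exact: continuous_expR.
    by apply: cvgN; apply: cvgM => //; exact: cvg_cst.
  - apply: (@bounded_itv_integrable _ _ _ 0 pi 1) => //.
      by move=> u /=; rewrite !in_itv/= => /andP[? ?]; rewrite !ltW.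
    by move=> u _; rewrite normr1.
  - move=> n u; rewrite /= in_itv/= => u0.
    rewrite ger0_norm ?expR_ge0// -[leRHS]expR0 ler_expR oppr_le0 mulr_ge0//.
      exact: kap0.
    exact: B0.
have h2 : \int[mu]_b S b (m - n%:R) - \int[mu]_b S b m @[n --> \oo] -->
    pi / 2 * \int[P]_w (1 - Num.sg (Y w - m)).
  under eq_fun do rewrite gp.
  apply: cvgM; first exact: cvg_cst.
  apply: (@dominated_Rintegral _ _ _ P setT
    (fun n w => Num.sg (Y w - (m - n%:R)) - Num.sg (Y w - m))
    (fun w => 1 - Num.sg (Y w - m)) (fun=> 2)) => //.
  - move=> n; apply/measurable_EFinP; exact: (measurable_int P (integrable_sgB _ _ _)).
  - move=> w _; apply: cvgB; last exact: cvg_cst.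
    apply: cvg_near_cst; near=> n.
    have h : m - Y w < n%:R by near: n; exact: nbhs_infty_gtr.
    by rewrite gtr0_sg//; lra.
  - exact: finite_measure_integrable_cst.
  - by move=> n w _; exact: normr_sgB_le.
(* With I the integral sought, the two limits give pi/2 - (I - pi/2) = pi/2. *)
have := cvgn_unique h1 h2.
by rewrite median_sg// IS//; lra.
Unshelve. all: end_near. Qed.

End median_equation.

(** * From the Laplace transform to the Fourier transform *)

Section window.
Context {R : realType}.
Notation mu := (@lebesgue_measure R).

Local Notation W a0 := `[a0 - 2, a0 + 2]%classic.

Lemma Rintegral_itv_cst (a b c : R) : a <= b ->
  \int[mu]_(x in `[a, b]) c = c * (b - a).
Proof.
move=> ab; rewrite Rintegral_cst//.
have := @lebesgue_measure_itv R `[a, b].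
rewrite /= lte_fin => ->.
have [ab'|] := ltP a b; first by rewrite -EFinB.
by move=> ba; rewrite (_ : b = a) ?subrr//; apply/eqP; rewrite eq_le ba.
Qed.

(* Takes the place of analytic continuation: averages against Gaussian windows
   of width n^(-1/2) that are exponentially small force the value to be 0. *)
Lemma gauss_window_eq0 (D : R -> R) (M K r a0 : R) :
  (forall a, continuous_at a D) -> (forall a, `|D a| <= M) -> 0 < r ->
  (forall n, `|\int[mu]_(a in W a0) (expR (- (n%:R / 2 * (a - a0) ^+ 2)) * D a)|
     <= K * expR (- (r * n%:R))) ->
  D a0 = 0.
Proof.
wlog : D / 0 <= D a0.
  move=> wl cD DM r0 DK.
  have [D0|D0] := lerP 0 (D a0); first exact: wl.
  have : (fun a => - D a) a0 = 0.
    apply: (wl (fun a => - D a)) => //; first by rewrite /=; lra.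
    - by move=> a; apply: continuous_at_fN; exact: cD.
    - by move=> a; rewrite normrN.
    - move=> n; rewrite -normrN -[X in `|X|]mulN1r -RintegralZl//.
        by under eq_Rintegral do rewrite mulrN mulN1r opprK.
      apply: continuous_itv_integrable => a _; apply: continuous_at_fM; cont.
      exact: cD.
  by rewrite /=; lra.
move=> D0 cD DM r0 DK; apply/eqP; rewrite eq_le D0 andbT leNgt; apply/negP => Da0.
pose c := D a0 / 2.
have c0 : 0 < c by rewrite /c; lra.
have [e1 e10 De1] : exists2 e1 : R, 0 < e1 & forall a, `|a - a0| < e1 -> c <= D a.
  have /cvgrPdist_lt/(_ c c0)[e1 /= e10 h] := cD a0.
  exists e1 => // a aa0; have := h a; rewrite /= distrC => /(_ aa0).
  by rewrite ltr_norml /c; lra.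
(* s < e1 keeps D >= c for |a - a0| < s; s <= 1 gives s^2 <= s and keeps the small interval inside
   the window; s <= r makes the right-hand side decay faster than the central contribution. *)
pose s := Num.min (Num.min 1 (e1 / 2)) r.
have s0 : 0 < s by rewrite /s !lt_min ltr01 r0 andbT; lra.
have s1 : s <= 1 by rewrite /s !ge_min lexx.
have se1 : s <= e1 / 2 by rewrite /s !ge_min lexx orbT.
have sr : s <= r by rewrite /s !ge_min lexx !orbT.
have ss : s ^+ 2 <= s by rewrite expr2 ler_piMr// ltW.
have M0 : 0 <= M by rewrite (le_trans (normr_ge0 _) (DM a0)).
(* For |a - a0| <= s/2, an interval of length s, the Gaussian is at least exp (- s^2 n / 8) and D >=
   c. For |a - a0| >= s it is at most exp (- s^2 n / 2) and D >= - M, over a window of length 4. In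
   between the integrand is nonnegative. *)
have key n : c * s * expR (- (s ^+ 2 / 8 * n%:R)) - 4 * M * expR (- (s ^+ 2 / 2 * n%:R)) <=
    K * expR (- (r * n%:R)).
  apply: le_trans (le_trans (ler_norm _) (DK n)).
  pose J : set (measurableTypeR R) := `[a0 - s / 2, a0 + s / 2]%classic.
  pose h a : R := c * expR (- (s ^+ 2 / 8 * n%:R)) * \1_J a
     - M * expR (- (s ^+ 2 / 2 * n%:R)).
  have mJ : measurable J by rewrite /J; exact: measurable_itv.
  have JW : J `<=` W a0 by move=> a; rewrite /J /= !in_itv/=; lra.
  have i1 : mu.-integrable (W a0) (EFin \o (fun a =>
      c * expR (- (s ^+ 2 / 8 * n%:R)) * \1_J a)).
    apply: (@bounded_itv_integrable _ _ _ (a0 - 2) (a0 + 2)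
      (c * expR (- (s ^+ 2 / 8 * n%:R)))) => //.
      by apply: measurable_funM => //; exact: measurable_indic.
    move=> a _; rewrite normrM ger0_norm ?mulr_ge0 ?expR_ge0 ?(ltW c0)//.
    rewrite ler_piMr ?mulr_ge0 ?expR_ge0 ?(ltW c0)// indicE.
    by case: (_ \in _); rewrite ?normr1 ?normr0.
  have i2 : mu.-integrable (W a0) (EFin \o (fun a => M * expR (- (s ^+ 2 / 2 * n%:R)))).
    by apply: continuous_integrable; exact: cst_continuous.
  have -> : c * s * expR (- (s ^+ 2 / 8 * n%:R)) - 4 * M * expR (- (s ^+ 2 / 2 * n%:R)) =
      \int[mu]_(a in W a0) h a.
    rewrite RintegralB// Rintegral_itv_cst; last lra.
    have -> : \int[mu]_(a in W a0) (c * expR (- (s ^+ 2 / 8 * n%:R)) * \1_J a) =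
        \int[mu]_(a in J) (c * expR (- (s ^+ 2 / 8 * n%:R))).
      rewrite -[J in RHS](setIidr JW) Rintegral_mkcondr; apply: eq_Rintegral => a _.
      by rewrite patchE indicE; case: (_ \in _); rewrite ?mulr1 ?mulr0.
    rewrite Rintegral_itv_cst; last lra.
    by field.
  apply: le_Rintegral => //.
  - exact: (integrableB _ i1 i2).
  - apply: continuous_itv_integrable => a _; apply: continuous_at_fM; first by cont.
    exact: cD.
  - move=> a Wa; rewrite /h indicE; pose q := (a - a0) ^+ 2.
    have Dle := DM a; rewrite ler_norml in Dle.
    have n2 : 0 <= n%:R / 2 :> R by rewrite divr_ge0.
    have [|aJ] := boolP (a \in J).
      rewrite inE /J/= in_itv/= mulr1 => aJ.
      have cDa : c <= D a by apply: De1; rewrite ltr_norml; lra.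
      rewrite (@le_trans _ _ (expR (- (n%:R / 2 * (a - a0) ^+ 2)) * c))//; last first.
        by rewrite ler_pM2l ?expR_gt0.
      rewrite (@le_trans _ _ (c * expR (- (s ^+ 2 / 8 * n%:R))))//.
        by rewrite gerBl mulr_ge0 ?expR_ge0.
      rewrite mulrC ler_pM2r// ler_expR lerN2.
      have q4 : (a - a0) ^+ 2 <= s ^+ 2 / 4.
        rewrite (_ : s ^+ 2 / 4 = (s / 2) ^+ 2); last by field.
        rewrite -(real_normK (num_real (a - a0))) lerXn2r ?nnegrE ?divr_ge0 ?(ltW s0)//.
        by rewrite ler_norml; lra.
      by rewrite (le_trans (ler_wpM2l n2 q4))// le_eqVlt; apply/orP; left; apply/eqP; by field.
    rewrite mulr0 sub0r; have [sa|sa] := ltP `|a - a0| s.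
      have cDa : c <= D a by apply: De1; lra.
      rewrite (@le_trans _ _ 0)// ?oppr_le0 ?mulr_ge0 ?expR_ge0//.
      by rewrite (le_trans (ltW c0)).
    rewrite (@le_trans _ _ (expR (- (n%:R / 2 * (a - a0) ^+ 2)) * - M))//; last first.
      by rewrite ler_pM2l ?expR_gt0//; lra.
    rewrite mulrN lerN2 mulrC ler_wpM2l// ler_expR lerN2.
    have q4 : s ^+ 2 <= (a - a0) ^+ 2.
      by rewrite -(real_normK (num_real (a - a0))) lerXn2r ?nnegrE ?(ltW s0).
    apply: le_trans (ler_wpM2l n2 q4); rewrite le_eqVlt; apply/orP; left; apply/eqP; by field.
have s20 : 0 < s ^+ 2 by rewrite exprn_gt0.
(* Division by exp (- s^2 n / 8): the remaining rates are 3 s^2 / 8 >= s^2 / 4 and, since s^2 <= s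
   <= r, r - s^2 / 8 >= s / 2. *)
have key2 n : c * s <= 4 * M * expR (- (s ^+ 2 / 4 * n%:R)) + `|K| * expR (- (s / 2 * n%:R)).
  have := key n; rewrite lerBlDl => h.
  have e0 : 0 < expR (- (s ^+ 2 / 8 * n%:R)) :> R by exact: expR_gt0.
  rewrite -(ler_pM2r e0); apply: (le_trans h); rewrite [leRHS]mulrDl lerD//.
    rewrite -!mulrA ler_wpM2l// ler_wpM2l// -expRD ler_expR.
    have := mulr_ge0 (ltW s20) (ler0n R n); lra.
  rewrite (@le_trans _ _ (`|K| * expR (- (r * n%:R))))//.
    by rewrite ler_wpM2r ?expR_ge0// ler_norm.
  rewrite -[leRHS]mulrA ler_wpM2l// -expRD ler_expR.
  have n0 := ler0n R n.
  have h1 := ler_wpM2r n0 sr; have h3 := mulr_ge0 n0 (ltW s0); have h2 := ler_wpM2r n0 ss; lra.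
have lim : 4 * M * expR (- (s ^+ 2 / 4 * n%:R)) + `|K| * expR (- (s / 2 * n%:R))
    @[n --> \oo] --> 4 * M * 0 + `|K| * 0.
  apply: cvgD; (apply: cvgM; [exact: cvg_cst|apply: cvgn_expRN]); lra.
have : c * s <= 0.
  rewrite (_ : 0 = 4 * M * 0 + `|K| * 0); last by rewrite !mulr0 addr0.
  by apply: (cvgr_to_ge lim); exact: nearW.
by rewrite leNgt mulr_gt0.
Qed.

End window.

Section laplace_fourier.
Context {R : realType}.
Notation mu := (@lebesgue_measure R).
Local Notation W a0 := `[a0 - 2, a0 + 2]%classic.

(** The imaginary part, on the real line, of e^(i psi) times the Gaussian exp (- n/2 (z - a0 - i
    pi/2)^2), which is real on the line y = pi/2. *)
Let w (n : nat) (a0 psi a : R) : R :=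
  expR (- (n%:R / 2 * ((a - a0) ^+ 2 - (pi / 2) ^+ 2))) * sin (psi + n%:R * (a - a0) * (pi / 2)).

(** On the sides |a - a0| = 2 of the rectangle the Gaussian has modulus at most exp (- rate n): 4 is
    the squared half-width, (pi/2)^2 the largest value of (y - pi/2)^2 on [0, pi/2]. *)
Let rate : R := (4 - (pi / 2) ^+ 2) / 2.

Let rate_gt0 : 0 < rate.
Proof.
have /andP[p0 p2] := pihalf_02 R.
rewrite /rate divr_gt0// subr_gt0; set x := pi / 2 in p0 p2 *.
have : 0 < (2 - x) * (2 + x) by rewrite mulr_gt0//; lra.
lra.
Qed.

(* The window exp (- n (z - a0)^2 / 2) is holomorphic, so the line y = pi/2 can
   be moved to y = 0, where only the Laplace transform is involved.  The sides of
   the rectangle contribute exp (- rate n) since the half-width 2 exceeds pi/2. *)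
Lemma window_cauchy (t be a0 psi : R) (n : nat) : 0 <= t -> 0 < be <= 1 ->
  `| \int[mu]_(a in W a0) (expR (- (n%:R / 2 * (a - a0) ^+ 2)) *
       (expR (- (t * expR (be * a) * cos (be * (pi / 2)))) *
        sin (psi - t * expR (be * a) * sin (be * (pi / 2))))) -
     \int[mu]_(a in W a0) (expR (- (t * expR (be * a))) * w n a0 psi a) | <=
  pi * expR (- (rate * n%:R)).
Proof.
move=> t0 /andP[be0 be1].
have p0 := pi_gt0 R.
pose N : R := n%:R.
have N0 : 0 <= N by exact: ler0n.
(* With z = a + i y, P + i Q = i psi - t e^(be z) - n/2 (z - a0 - i pi/2)^2. The curves a = cst are
   vertical lines, whence slope 0 in Cauchy's theorem; -1 < y < pi is an open strip around
   [0, pi/2]. *)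
pose P a y : R := - (t * expR (be * a) * cos (be * y)) -
  N / 2 * ((a - a0) ^+ 2 - (y - pi / 2) ^+ 2).
pose Q a y : R := psi - t * expR (be * a) * sin (be * y) - N * (a - a0) * (y - pi / 2).
pose Pa a y : R := - (t * be * expR (be * a) * cos (be * y)) - N * (a - a0).
pose Qa a y : R := - (t * be * expR (be * a) * sin (be * y)) - N * (y - pi / 2).
have dPa (x y : R) : -1 < y < pi -> is_derive x 1 (P^~ y) (Pa x y).
  by move=> _; rewrite /P /Pa; derive; field.
have dQa (x y : R) : -1 < y < pi -> is_derive x 1 (Q^~ y) (Qa x y).
  by move=> _; rewrite /Q /Qa; derive; field.
have dPy (x y : R) : -1 < y < pi -> is_derive y 1 (P x) (0 * Pa x y - Qa x y).
  by move=> _; rewrite /P /Qa; derive; field.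
have dQy (x y : R) : -1 < y < pi -> is_derive y 1 (Q x) (0 * Qa x y + Pa x y).
  by move=> _; rewrite /Q /Pa; derive; field.
have cP (x y : R) : -1 < y < pi -> continuous_at (x, y) (fun z : R * R => P z.1 z.2).
  by move=> _; rewrite /P; cont.
have cQ (x y : R) : -1 < y < pi -> continuous_at (x, y) (fun z : R * R => Q z.1 z.2).
  by move=> _; rewrite /Q; cont.
have cPa (x y : R) : -1 < y < pi -> continuous_at (x, y) (fun z : R * R => Pa z.1 z.2).
  by move=> _; rewrite /Pa; cont.
have cQa (x y : R) : -1 < y < pi -> continuous_at (x, y) (fun z : R * R => Qa z.1 z.2).
  by move=> _; rewrite /Qa; cont.
have ca (y : R) : -1 < y < pi -> continuous_at y (fun _ : R => 0 : R).
  by move=> _; exact: cst_continuous.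
have h : a0 - 2 <= a0 + 2 by lra.
have h1 : -1 < 0 :> R by lra.
have h2 : 0 <= pi / 2 :> R by lra.
have h3 : pi / 2 < pi :> R by lra.
have C := cauchy_exp h h1 h2 h3 dPa dQa dPy dQy cP cQ cPa cQa ca.
cbv zeta in C.
set I1 := \int[mu]_(x in _) _; set I2 := \int[mu]_(x in _) _.
rewrite (_ : I1 - I2 = \int[mu]_(y in `[0, pi / 2])
    (expR (P (a0 + 2) y) * (0 * sin (Q (a0 + 2) y) + cos (Q (a0 + 2) y)) -
     expR (P (a0 - 2) y) * (0 * sin (Q (a0 - 2) y) + cos (Q (a0 - 2) y)))); last first.
  rewrite -C; congr (_ - _); apply: eq_Rintegral => a _; rewrite /P /Q.
    by rewrite subrr expr0n/= !subr0 mulr0 subr0 [in RHS]expRD mulrA (mulrC (expR (- (N / 2 * _)))).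
  rewrite /w mulr0 cos0 sin0 !mulr0 mulr1 subr0 sub0r.
  by rewrite sqrrN [in RHS]expRD [LHS]mulrA mulrN opprK.
have cg (x y : R) : -1 < y < pi -> continuous_at y
    (fun y => expR (P x y) * (0 * sin (Q x y) + cos (Q x y))).
  move=> y0; have d1 := dPy x y y0; have d2 := dQy x y y0.
  by cont; apply: is_derive_cont; eassumption.
have ig : mu.-integrable `[0, pi / 2] (EFin \o (fun y =>
     expR (P (a0 + 2) y) * (0 * sin (Q (a0 + 2) y) + cos (Q (a0 + 2) y)) -
     expR (P (a0 - 2) y) * (0 * sin (Q (a0 - 2) y) + cos (Q (a0 - 2) y)))).
  apply: continuous_itv_integrable => y y2.
  by apply: continuous_at_fD; [|apply: continuous_at_fN]; apply: cg; lra.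
apply: le_trans (le_normr_Rintegral _ ig) _ => //.
(* Two sides of length pi/2, each with integrand at most exp (- rate n). *)
have -> : pi * expR (- (rate * N)) = \int[mu]_(y in `[0, pi / 2]) (2 * expR (- (rate * N))).
  by rewrite Rintegral_itv_cst//; field.
apply: le_Rintegral => //.
- exact: integrable_norm.
- by apply: continuous_integrable; exact: cst_continuous.
have bd x y : (x - a0) ^+ 2 = 4 -> 0 <= y <= pi / 2 ->
    `|expR (P x y) * (0 * sin (Q x y) + cos (Q x y))| <= expR (- (rate * N)).
  move=> x2 y2; rewrite mul0r add0r normrM ger0_norm ?expR_ge0//.
  rewrite (@le_trans _ _ (expR (P x y)))//; first by rewrite ler_piMr ?expR_ge0// cos_max.
  rewrite ler_expR /P x2 /rate.
  (* Here be <= 1 matters: be * y stays in [0, pi/2], so exp (- t e^(be z)) has modulus at most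
     1. *)
  have c0 : 0 <= cos (be * y).
    apply: cos_ge0_pihalf.
    have b1 : 0 <= be * y by rewrite mulr_ge0 ?(ltW be0)//; case/andP: y2.
    have b2 : be * y <= y by rewrite ler_piMl//; case/andP: y2.
    lra.
  have t1 : 0 <= t * expR (be * x) * cos (be * y) by rewrite !mulr_ge0// expR_ge0.
  have y3 : (y - pi / 2) ^+ 2 <= (pi / 2) ^+ 2.
    rewrite -(real_normK (num_real (y - pi / 2))) lerXn2r ?nnegrE// ler_norml; lra.
  have := ler_wpM2l N0 y3; lra.
move=> y; rewrite /= in_itv/= => y2.
rewrite (le_trans (ler_normB _ _))// mulr_natl mulr2n lerD//; apply: bd => //; ring.
Qed.

Context d {T : measurableType d} (Pr : probability T R).

(** This is E exp (- l Z) = exp (- l^al) at l = i e^a0, where l^al = e^(al a0) e^(i al pi/2),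
    multiplied by e^(i psi) and reduced to its imaginary part. Window averages of either side at
    height pi/2 are exponentially close to averages over the real line, and there the two sides
    agree by hypothesis; [gauss_window_eq0] then applies to their difference. *)
Lemma laplace_sin_ge0 (Z : T -> R) (al a0 psi : R) :
  measurable_fun setT Z -> (forall x, 0 <= Z x) -> 0 < al < 1 ->
  (forall l, 0 <= l -> \int[Pr]_x expR (- (l * Z x)) = expR (- (l `^ al))) ->
  \int[Pr]_x sin (psi - expR a0 * Z x) =
    expR (- (expR (al * a0) * cos (al * (pi / 2)))) *
    sin (psi - expR (al * a0) * sin (al * (pi / 2))).
Proof.
move=> mZ Z0 al01 hZ.
have al0 : 0 < al by case/andP: al01.
have al1 : 0 < al <= 1 by case/andP: al01 => -> /ltW ->.
pose F a := \int[Pr]_x sin (psi - expR a * Z x).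
pose G a := expR (- (expR (al * a) * cos (al * (pi / 2)))) *
    sin (psi - expR (al * a) * sin (al * (pi / 2))).
suff : (fun a => F a - G a) a0 = 0 by move/eqP; rewrite subr_eq0 => /eqP.
have msin a : measurable_fun setT (fun x => sin (psi - expR a * Z x)).
  by apply: measurable_fsin; apply: measurable_funB => //; exact: measurable_funM.
have icst (c : R) : Pr.-integrable setT (EFin \o (fun=> c)).
  exact: finite_measure_integrable_cst.
have isin a : Pr.-integrable setT (EFin \o (fun x => sin (psi - expR a * Z x))).
  apply: (le_integrable measurableT _ _ (icst 1)); first exact/measurable_EFinP.
  by move=> x _ /=; rewrite lee_fin normr1 sin_max.
have intc (c : R) : \int[Pr]_x c = c.
  by rewrite /Rintegral integral_cst//= probability_setT mule1.
have F1 a : `|F a| <= 1.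
  rewrite /F (le_trans (le_normr_Rintegral _ (isin a)))// -[leRHS]intc.
  apply: le_Rintegral => //; first exact: integrable_norm.
  by move=> x _; exact: sin_max.
have cF (a : R) : continuous_at a F.
  have Ia : a \in (`]a - 1, a + 1[%classic : set R).
    by rewrite inE/= in_itv/=; lra.
  apply: (continuity_under_integral (f := fun a x => sin (psi - expR a * Z x))
    (B := setT) measurableT (fun a _ => isin a) _ (icst 1) _ Ia).
  - by apply: aeW => x _ b _; cont.
  - by move=> b _; apply: aeW => x _; exact: sin_max.
have p0 := pi_gt0 R.
have c0 : 0 <= cos (al * (pi / 2)).
  apply: cos_ge0_pihalf.
  have h1 : 0 <= al * (pi / 2) by rewrite mulr_ge0 ?(ltW al0)// divr_ge0// ltW.
  have h2 : al * (pi / 2) <= pi / 2.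
    by rewrite ler_piMl// ?divr_ge0 ?(ltW p0)//; case/andP: al1.
  lra.
have G1 a : `|G a| <= 1.
  rewrite /G normrM ger0_norm ?expR_ge0// mulr_ile1 ?expR_ge0 ?sin_max//.
  by rewrite -[leRHS]expR0 ler_expR oppr_le0 mulr_ge0 ?expR_ge0.
have cG (a : R) : continuous_at a G by rewrite /G; cont.
apply: (@gauss_window_eq0 _ (fun a => F a - G a) 2 (2 * pi) rate a0) => //.
- by move=> a; exact: (continuous_at_fD (cF a) (continuous_at_fN (cG a))).
- by move=> a; rewrite (le_trans (ler_normB _ _))//; have := F1 a; have := G1 a; lra.
move=> n.
pose gam a : R := expR (- (n%:R / 2 * (a - a0) ^+ 2)).
have cgam : continuous gam by move=> a; rewrite /gam; cont.
have cw : continuous (w n a0 psi) by move=> a; rewrite /w; cont.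
have -> : \int[mu]_(a in W a0) (expR (- (n%:R / 2 * (a - a0) ^+ 2)) * (F a - G a)) =
    \int[mu]_(a in W a0) (gam a * F a) - \int[mu]_(a in W a0) (gam a * G a).
  rewrite -RintegralB//.
  - by apply: eq_Rintegral => a _; rewrite mulrBr.
  - by apply: continuous_integrable => a; exact: (continuous_at_fM (cgam a) (cF a)).
  - by apply: continuous_integrable => a; exact: (continuous_at_fM (cgam a) (cG a)).
have swap (H : R -> T -> R) (k : R -> R) : measurable_fun setT (fun z : T * R => H z.2 z.1) ->
    (forall a x, `|H a x| <= 1) -> continuous k ->
    Pr.-integrable setT (EFin \o (fun x => \int[mu]_(a in W a0) (k a * H a x))) /\
    \int[Pr]_x \int[mu]_(a in W a0) (k a * H a x) =
    \int[mu]_(a in W a0) (k a * \int[Pr]_x H a x).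
  move=> mH H1 ck.
  pose J : set (measurableTypeR R) := W a0.
  have mJ : measurable J by rewrite /J; exact: measurable_itv.
  have iH a : Pr.-integrable setT (EFin \o H a).
    apply: (le_integrable measurableT _ _ (icst 1)).
      by apply/measurable_EFinP; exact: (measurable_fun_pair1 a mH).
    by move=> x _ /=; rewrite lee_fin normr1.
  have EJ (f : R -> R) : \int[mu]_(a in W a0) f a = \int[mu]_a (\1_J a * f a).
    rewrite Rintegral_mkcond; apply: eq_Rintegral => a _.
    by rewrite patchE indicE; case: (_ \in _); rewrite ?mul1r ?mul0r.
  have [|||iE E] := @Fubini_dominated _ _ _ Pr (fun x a => \1_J a * (k a * H a x))
      (fun a => \1_J a * `|k a|).
  - apply: measurable_funM.
      by apply: (measurableT_comp _ measurable_snd); exact: measurable_indic.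
    apply: measurable_funM => //.
    by apply: (measurableT_comp _ measurable_snd); exact: continuous_measurable_fun.
  - have : mu.-integrable J (EFin \o (fun a => `|k a|)).
      by apply: integrable_norm; exact: continuous_integrable.
    move/(integrable_mkcond _ mJ); apply: eq_integrable => // a _.
    by rewrite patchE /= indicE; case: (_ \in _); rewrite ?mul1r ?mul0r.
  - move=> x a; rewrite !normrM ler_pM//.
      by rewrite indicE; case: (_ \in _); rewrite ?normr1 ?normr0.
    by rewrite ler_piMr.
  split; first by under [X in EFin \o X]eq_fun do rewrite EJ.
  rewrite EJ; under eq_Rintegral do rewrite EJ.
  rewrite E; apply: eq_Rintegral => a _.
  by under eq_Rintegral do rewrite mulrA; rewrite RintegralZl// mulrA.
(* [I1] is the window average at height pi/2 for a fixed sample point, [J1] its counterpart on the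
   real line. Only the expectation of [J1] calls on the Laplace transform, at l = e^a.
   [window_cauchy] is used with be = 1 to compare [I1] with [J1], and with t = 1, be = al for [G];
   each use costs pi exp (- rate n), hence the constant 2 pi. *)
pose I1 x := \int[mu]_(a in W a0) (gam a * sin (psi - expR a * Z x)).
pose J1 x := \int[mu]_(a in W a0) (w n a0 psi a * expR (- (expR a * Z x))).
have [iI1 E1] : Pr.-integrable setT (EFin \o I1) /\
    \int[Pr]_x I1 x = \int[mu]_(a in W a0) (gam a * F a).
  apply: (swap (fun a x => sin (psi - expR a * Z x))) => //.
    apply: measurable_fsin; apply: measurable_funB => //; apply: measurable_funM.
      by apply: measurable_fexp; exact: measurable_snd.
    exact: (measurableT_comp mZ measurable_fst).
  by move=> a x; exact: sin_max.
have [iJ1 E2] : Pr.-integrable setT (EFin \o J1) /\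
    \int[Pr]_x J1 x = \int[mu]_(a in W a0) (w n a0 psi a * expR (- (expR (al * a)))).
  have [||//|iJ ->] := swap (fun a x => expR (- (expR a * Z x))) (w n a0 psi).
  - apply: measurable_fexp; apply: measurable_funN; apply: measurable_funM.
      by apply: measurable_fexp; exact: measurable_snd.
    exact: (measurableT_comp mZ measurable_fst).
  - move=> a x; rewrite ger0_norm ?expR_ge0// -[leRHS]expR0 ler_expR oppr_le0.
    by rewrite mulr_ge0 ?expR_ge0.
  split=> //; apply: eq_Rintegral => a _.
  by rewrite hZ ?expR_ge0// -expRM (mulrC a).
have d1 : `|\int[Pr]_x I1 x - \int[Pr]_x J1 x| <= pi * expR (- (rate * n%:R)).
  rewrite -RintegralB//.
  have iIJ : Pr.-integrable setT (EFin \o (fun x => I1 x - J1 x)).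
    exact: (integrableB measurableT iI1 iJ1).
  rewrite (le_trans (le_normr_Rintegral _ iIJ))//.
  rewrite -[leRHS]intc.
  apply: le_Rintegral => //; first exact: integrable_norm.
  move=> x _.
  have := @window_cauchy (Z x) 1 a0 psi n (Z0 x) (_ : 0 < 1 <= 1).
  rewrite ltr01 lexx => /(_ isT); apply: le_trans; rewrite le_eqVlt; apply/orP; left; apply/eqP.
  congr (`|_ - _|); apply: eq_Rintegral => a _; rewrite !mul1r.
    by rewrite cos_pihalf sin_pihalf mulr0 oppr0 expR0 mul1r mulr1 (mulrC (Z x)).
  by rewrite mulrC (mulrC (Z x)).
have d2 : `|\int[mu]_(a in W a0) (gam a * G a) - \int[Pr]_x J1 x| <= pi * expR (- (rate * n%:R)).
  rewrite E2; have := @window_cauchy 1 al a0 psi n ler01 al1.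
  apply: le_trans; rewrite le_eqVlt; apply/orP; left; apply/eqP.
  congr (`|_ - _|); apply: eq_Rintegral => a _; first by rewrite /G !mul1r.
  by rewrite mul1r mulrC.
rewrite -E1.
have := ler_normB (\int[Pr]_x I1 x - \int[Pr]_x J1 x)
  (\int[mu]_(a in W a0) (gam a * G a) - \int[Pr]_x J1 x).
rewrite opprB addrA subrK; lra.
Qed.

End laplace_fourier.

(** * The laws of log S and of Z_alpha *)

Section shift.
Context {R : realType}.
Notation mu := (@lebesgue_measure R).

Lemma ge0_integral_shift (f : R -> R) (c : R) : continuous f -> (forall x, 0 <= f x) ->
  (\int[mu]_x (f (x - c))%:E = \int[mu]_x (f x)%:E)%E.
Proof.
move=> cf f0; pose F (x : R) : R := x - c.
have dF (x : R) : is_derive x 1 F 1 by rewrite /F; derive_ring.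
have F1 : F^`()%classic = cst 1.
  by apply/funext => x; rewrite derive1E (@derive_val _ _ _ _ _ _ _ (dF x)).
rewrite [RHS](@increasing_ge0_integration_by_substitutionT _ F f) ?F1//.
- by apply: eq_integral => x _; rewrite !fctE mulr1.
- by move=> x y xy; rewrite /F ltrD2r.
- by move=> x; exact: cst_continuous.
- exact: is_cvg_cst.
- exact: is_cvg_cst.
- apply/cvgrNyPle => A; near=> x; rewrite /F lerBlDr; near: x.
  by apply: nbhs_ninfty_le; exact: num_real.
- apply/cvgryPge => A; near=> x; rewrite /F lerBrDr; near: x.
  by apply: nbhs_pinfty_ge; exact: num_real.
Unshelve. all: end_near. Qed.

(** Reduction to nonnegative functions through f = (f + |f|) - |f|, which preserves continuity. *)
Lemma Rintegral_shift (f : R -> R) (c : R) : continuous f ->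
  mu.-integrable setT (EFin \o f) ->
  mu.-integrable setT (EFin \o (fun x => f (x - c))) /\
  \int[mu]_x f (x - c) = \int[mu]_x f x.
Proof.
move=> cf fi.
have cfc : continuous (fun x => f (x - c)).
  by move=> x; apply: continuous_at_fcomp; [exact: cf|cont].
have cn (g : R -> R) : continuous g -> continuous (fun x => `|g x|).
  by move=> cg x; apply: continuous_at_fcomp; [exact: norm_continuous|exact: cg].
have fci : mu.-integrable setT (EFin \o (fun x => f (x - c))).
  apply/integrableP; split; first by apply/measurable_EFinP; exact: continuous_measurable_fun.
  rewrite (@ge0_integral_shift (fun x => `|f x|))//; last exact: cn.
  by case/integrableP : fi.
split=> //.
have E (g : R -> R) : continuous g -> (forall x, 0 <= g x) ->
    \int[mu]_x g (x - c) = \int[mu]_x g x.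
  by move=> cg g0; rewrite /Rintegral ge0_integral_shift.
have fn := integrable_norm fi; have fcn := integrable_norm fci.
have S (g : R -> R) : mu.-integrable setT (EFin \o g) ->
    \int[mu]_x g x = \int[mu]_x (g x + `|g x|) - \int[mu]_x `|g x|.
  by move=> gi; rewrite RintegralD// ?addrK//; exact: integrable_norm.
rewrite (S (fun x => f (x - c)))// (S f)//; congr (_ - _).
  apply: (E (fun x => f x + `|f x|)) => [x|x].
    by apply: continuous_at_fD; [exact: cf|exact: cn].
  by have := ler_norm (- f x); rewrite normrN; lra.
by apply: (E (fun x => `|f x|)) => //; exact: cn.
Qed.

End shift.

Section log_S.
Context {R : realType}.
Notation mu := (@lebesgue_measure R).

(** E sin (e^b (X - y)) for X = log S, as read off the characteristic function at l = e^b. *)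
Definition logS_sine (b y : R) : R :=
  expR (- (pi / 2 * expR b)) * sin (expR b * (b - 1 - y)).
(** The analogue for S of Zolotarev's function; its exponent 1 - u cot u is the abscissa at height u
    of the curve on which the phase vanishes. *)
Definition zolotarev_S (u : R) : R := expR (1 - u * cos u / sin u) * u / sin u.

(* Below, P + i Q = e^y e^z (z - 1) at z = a(u) + b + i u, and a is such that
   Q vanishes at b = 0. *)
Lemma logS_sine_integral (y : R) : mu.-integrable setT (EFin \o logS_sine^~ y) /\
  \int[mu]_b logS_sine b y =
  \int[mu]_(u in `]0, pi[) expR (- (expR y * zolotarev_S u)) - pi / 2.
Proof.
have p0 := pi_gt0 R.
pose kap : R := expR y.
have kap0 : 0 < kap by exact: expR_gt0.
pose a (u : R) : R := 1 - u * cos u / sin u.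
pose a' (u : R) : R := u / sin u ^+ 2 - cos u / sin u.
pose P (b u : R) : R := kap * (expR (a u + b) * ((a u + b - 1) * cos u - u * sin u)).
pose Q (b u : R) : R := kap * (expR (a u + b) * ((a u + b - 1) * sin u + u * cos u)).
pose Pb (b u : R) : R := kap * (expR (a u + b) * ((a u + b) * cos u - u * sin u)).
pose Qb (b u : R) : R := kap * (expR (a u + b) * ((a u + b) * sin u + u * cos u)).
have s0 (u : R) : 0 < u < pi -> sin u != 0 by move=> /sin_gt0_pi/lt0r_neq0.
have da (u : R) : 0 < u < pi -> is_derive u 1 a (a' u).
  move=> u0; rewrite /a /a'; derive; first exact: s0.
  rewrite [in RHS](_ : u / sin u ^+ 2 = u * (cos u ^+ 2 + sin u ^+ 2) / sin u ^+ 2).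
    by field; exact: s0.
  by rewrite cos2Dsin2 mulr1.
have dPb (x u : R) : 0 < u < pi -> is_derive x 1 (P^~ u) (Pb x u).
  by move=> _; rewrite /P /Pb; derive_ring.
have dQb (x u : R) : 0 < u < pi -> is_derive x 1 (Q^~ u) (Qb x u).
  by move=> _; rewrite /Q /Qb; derive_ring.
have dPu (x u : R) : 0 < u < pi -> is_derive u 1 (P x) (a' u * Pb x u - Qb x u).
  by move=> u0; have h := da u u0; rewrite /P /Pb /Qb; derive_ring.
have dQu (x u : R) : 0 < u < pi -> is_derive u 1 (Q x) (a' u * Qb x u + Pb x u).
  by move=> u0; have h := da u u0; rewrite /Q /Pb /Qb; derive_ring.
have ca1 (u : R) : 0 < u < pi -> continuous_at u a.
  by move=> u0; have h := da u u0; apply: is_derive_cont; eassumption.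
have cP (x u : R) : 0 < u < pi -> continuous_at (x, u) (fun z : R * R => P z.1 z.2).
  by move=> u0; rewrite /P; cont; exact: ca1.
have cQ (x u : R) : 0 < u < pi -> continuous_at (x, u) (fun z : R * R => Q z.1 z.2).
  by move=> u0; rewrite /Q; cont; exact: ca1.
have cPb (x u : R) : 0 < u < pi -> continuous_at (x, u) (fun z : R * R => Pb z.1 z.2).
  by move=> u0; rewrite /Pb; cont; exact: ca1.
have cQb (x u : R) : 0 < u < pi -> continuous_at (x, u) (fun z : R * R => Qb z.1 z.2).
  by move=> u0; rewrite /Qb; cont; exact: ca1.
have ca' (u : R) : 0 < u < pi -> continuous_at u a'.
  move=> u0; rewrite /a'; apply: continuous_at_fD; [|apply: continuous_at_fN];
    apply: continuous_at_fM; try (by cont); apply: continuous_at_fV; rewrite ?expf_neq0 ?s0//; cont.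
have QE (b u : R) : 0 < u < pi -> Q b u = kap * expR (a u) * (b * expR b) * sin u.
  by move=> u0; rewrite /Q expRD /a; field; exact: s0.
have PE (b u : R) : 0 < u < pi ->
    P b u = - (kap * expR (a u) * (expR b * (u / sin u - b * cos u))).
  move=> u0; rewrite /P expRD [in LHS](_ : (a u + b - 1) * cos u - u * sin u =
    - (u * (cos u ^+ 2 + sin u ^+ 2) / sin u - b * cos u)).
    by rewrite cos2Dsin2 mulr1; ring.
  by rewrite /a; field; exact: s0.
have Q0 (u : R) : 0 < u < pi -> Q 0 u = 0.
  by move=> u0; rewrite QE// mul0r mulr0 mul0r.
(* The linear factor is absorbed at the price of half the exponential rate, which is why the rate is
   1/2 in the bounds below. *)
have bexp (b : R) : `|b| * expR (- `|b|) <= 2 * expR (- (2^-1 * `|b|)).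
  have h := expR_ge1Dx (2^-1 * `|b|).
  rewrite (_ : - `|b| = - (2^-1 * `|b|) - (2^-1 * `|b|)); last by field.
  rewrite expRD mulrA ler_pM2r ?expR_gt0// expRN ler_pdivrMr ?expR_gt0//; lra.
have up0 (u : R) : 0 < u < pi -> 0 < u / sin u.
  by move=> u0; rewrite divr_gt0 ?sin_gt0_pi//; case/andP: u0.
have a_le1 (u : R) : 0 < u <= pi / 2 -> a u <= 1.
  move=> u0; rewrite /a gerBl divr_ge0 ?mulr_ge0//; first lra.
    by apply: cos_ge0_pihalf; lra.
  by apply: ltW; apply: sin_gt0_pi; lra.
have cos_le0 (u : R) : pi / 2 <= u < pi -> cos u <= 0.
  move=> u2; rewrite -(subrK (pi / 2) u) cosDpihalf oppr_le0; apply: sin_ge0_pi; lra.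
have a_ge1 (u : R) : pi / 2 <= u < pi -> 1 <= a u.
  move=> u0; rewrite /a lerDl oppr_ge0 mulr_le0_ge0//.
    by rewrite mulr_ge0_le0 ?cos_le0//; lra.
  by rewrite invr_ge0; apply: sin_ge0_pi; lra.
(* The first summand is for [Qle], where a <= 1 and [bexp] supplies the 2; the second is for
   [expPle]. *)
pose C := 2 * kap * expR 1 + kap^-1.
have Ple0 (b u : R) : b <= 0 -> 0 < u <= pi / 2 -> P b u <= 0.
  move=> b0 u0; rewrite PE; last lra.
  rewrite oppr_le0 !mulr_ge0 ?expR_ge0 ?(ltW kap0)// subr_ge0.
  have h1 : 0 < u / sin u by apply: up0; lra.
  have h2 : 0 <= cos u by apply: cos_ge0_pihalf; lra.
  by apply: le_trans (ltW h1); rewrite mulr_le0_ge0.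
have Qle (b u : R) : b <= 0 -> 0 < u <= pi / 2 -> `|Q b u| <= C * sin u * expR (2^-1 * b).
  move=> b0 u0; have su : 0 < sin u by apply: sin_gt0_pi; lra.
  rewrite QE; last lra.
  rewrite !normrM (gtr0_norm kap0) (gtr0_norm su) !(ger0_norm (expR_ge0 _)).
  have hb := bexp b; rewrite (ler0_norm b0) mulrN !opprK in hb; rewrite (ler0_norm b0).
  have ea : expR (a u) <= expR 1 by rewrite ler_expR a_le1.
  have h : kap * expR (a u) * (- b * expR b) <= C * expR (2^-1 * b).
    rewrite (@le_trans _ _ (kap * expR 1 * (2 * expR (2^-1 * b))))//.
      rewrite ler_pM ?mulr_ge0 ?expR_ge0 ?(ltW kap0)//; first by rewrite oppr_ge0.
      by rewrite ler_pM2l.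
    rewrite mulrA ler_pM2r ?expR_gt0// /C; have : 0 < kap^-1 by rewrite invr_gt0.
    lra.
  rewrite (@le_trans _ _ (C * expR (2^-1 * b) * sin u))//; first by rewrite ler_pM2r.
  by rewrite mulrAC.
have P_cvg0 (u : R) : 0 < u <= pi / 2 -> P (- n%:R) u @[n --> \oo] --> 0.
  move=> u0; have u0' : 0 < u < pi by lra.
  pose K := kap * expR (a u) * (u / sin u + 2).
  apply: (@cvgn_norm0 _ _ (fun n => K * expR (- (2^-1 * n%:R)))) => [n|].
    rewrite PE// normrN normrM (ger0_norm (_ : 0 <= kap * expR (a u))); last first.
      by rewrite mulr_ge0 ?expR_ge0 ?(ltW kap0).
    rewrite /K -[leRHS]mulrA ler_pM2l ?mulr_gt0 ?expR_gt0//.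
    rewrite normrM ger0_norm ?expR_ge0//.
    have hb := bexp n%:R; rewrite ger0_norm// in hb.
    have e1 : expR (- n%:R) <= expR (- (2^-1 * n%:R)) :> R.
      by rewrite ler_expR lerN2 ler_piMl//; lra.
    have h1 := up0 _ u0'.
    have h2 : `|u / sin u - - n%:R * cos u| <= u / sin u + n%:R.
      rewrite (le_trans (ler_normB _ _))// (gtr0_norm h1) lerD2l normrM normrN.
      by rewrite (ger0_norm (ler0n _ _)) ler_piMr// cos_max.
    apply: (le_trans (ler_wpM2l (expR_ge0 _) h2)).
    have := ler_wpM2l (ltW h1) e1; lra.
  rewrite -(mulr0 K); apply: cvgM; first exact: cvg_cst.
  by apply: cvgn_expRN; lra.
have expPle (b u : R) : 0 <= b -> pi / 2 <= u < pi ->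
    expR (P b u) <= C * sin u * expR (- (2^-1 * b)).
  move=> b0 u2; have u0 : 0 < u < pi by lra.
  have su : 0 < sin u by exact: sin_gt0_pi.
  have c0 := cos_le0 _ u2.
  (* For u >= pi/2: a u >= 1 bounds expR (a u) below by 1, cos u <= 0 lets the term in b be dropped,
     and u >= pi/2 >= 1. *)
  have PleK : P b u <= - (kap * expR b / sin u).
    rewrite PE// lerN2.
    have k1 : kap <= kap * expR (a u).
      by rewrite ler_peMr ?(ltW kap0)// -[leLHS]expR0 ler_expR (le_trans ler01)// a_ge1.
    have u1 : 1 <= u by have := pihalf_ge1 R; lra.
    have h1 : (sin u)^-1 <= u / sin u - b * cos u.
      rewrite (@le_trans _ _ (u / sin u))//.
        by rewrite ler_peMl// invr_ge0 ltW.
      by rewrite lerDl oppr_ge0 mulr_ge0_le0.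
    rewrite -mulrA ler_pM ?(ltW kap0) ?mulr_ge0 ?expR_ge0 ?invr_ge0 ?(ltW su)//.
    by rewrite ler_pM2l ?expR_gt0.
  have K0 : 0 < kap * expR b / sin u by rewrite divr_gt0 ?mulr_gt0 ?expR_gt0.
  (* exp (- K) <= 1 / K turns the growth of 1 / sin u near pi into the factor sin u that is
     required. *)
  rewrite (@le_trans _ _ (kap * expR b / sin u)^-1)//.
    rewrite (le_trans (_ : _ <= expR (- (kap * expR b / sin u))))// ?ler_expR//.
    rewrite expRN lef_pV2 ?posrE ?expR_gt0//.
    by have := expR_ge1Dx (kap * expR b / sin u); lra.
  have -> : (kap * expR b / sin u)^-1 = kap^-1 * sin u * expR (- b).
    by rewrite expRN; field; rewrite ?(lt0r_neq0 kap0) ?(s0 _ u0) ?lt0r_neq0 ?expR_gt0.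
  have C1 : kap^-1 <= C by rewrite /C lerDr !mulr_ge0 ?expR_ge0 ?(ltW kap0).
  rewrite ler_pM ?mulr_ge0 ?invr_ge0 ?expR_ge0 ?(ltW kap0) ?(ltW su)//.
    by rewrite ler_pM2r.
  by rewrite ler_expR lerN2 ler_piMl//; lra.
have k0 : 0 < 2^-1 :> R by lra.
have i0 := contour_integrable k0 dPb dQb Ple0 Qle expPle.
have I0 := contour_integral k0 dPb dQb dPu dQu cP cQ cPb cQb ca' Q0 Ple0 Qle P_cvg0 expPle.
have cf : continuous (fun b => expR (P b (pi / 2)) * sin (Q b (pi / 2))).
  by move=> b; rewrite /P /Q; cont.
(* At u = pi/2 one has a = 1; the shift absorbs this and the factor e^y, after which P + i Q = -
   (pi/2) e^b + i e^b (b - 1 - y). *)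
have [i1 I1] := Rintegral_shift (1 + y) cf i0.
have SE (b : R) : logS_sine b y =
    expR (P (b - (1 + y)) (pi / 2)) * sin (Q (b - (1 + y)) (pi / 2)).
  rewrite /logS_sine /P /Q /a sin_pihalf cos_pihalf mulr0 mul0r subr0.
  have -> : expR b = kap * expR (1 + (b - (1 + y))).
    by rewrite /kap -expRD; congr expR; ring.
  congr (expR _ * sin _); ring.
split; first by apply: eq_integrable i1 => // b _; rewrite /= SE.
under eq_Rintegral do rewrite SE.
rewrite I1 I0; congr (_ - _); apply: eq_Rintegral => u.
rewrite inE/= in_itv/= => u0; rewrite PE// expR0 mul0r subr0 mul1r.
by congr (expR (- _)); rewrite /zolotarev_S /kap /a; ring.
Qed.

End log_S.

Section stable.
Context {R : realType}.
Notation mu := (@lebesgue_measure R).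
Variable al : R.
Hypothesis al01 : 0 < al < 1.

(** E sin (e^b (- Z - y)) for Z = Z_alpha: the formula of [laplace_sin_ge0] with psi = - e^b y. *)
Definition stable_sine (b y : R) : R :=
  expR (- (expR (al * b) * cos (al * (pi / 2)))) *
  sin (- expR b * y - expR (al * b) * sin (al * (pi / 2))).
(** In the usual notation, (sin (al u)^al sin ((1 - al) u)^(1 - al) / sin u)^(1 / (1 - al)). *)
Definition zolotarev (u : R) : R :=
  expR (al / (1 - al) * (ln (sin (al * u)) - ln (sin u))) * sin ((1 - al) * u) / sin u.
(** For x > 0 this is the power x^(- al / (1 - al)). *)
Definition stable_rate (x : R) : R := expR (- (al / (1 - al) * ln x)).

(* Below, P + i Q = stable_rate x * (e^z - e^(al z)) at z = a(u) + b + i u, and a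
   is such that Q vanishes at b = 0. *)
Lemma stable_sine_integral (x : R) : 0 < x -> mu.-integrable setT (EFin \o stable_sine^~ (- x)) /\
  \int[mu]_b stable_sine b (- x) =
  \int[mu]_(u in `]0, pi[) expR (- (stable_rate x * zolotarev u)) - pi / 2.
Proof.
move=> x0; have p0 := pi_gt0 R; have /andP[al0 al1] := al01.
have al1' : 1 - al != 0 by rewrite lt0r_neq0//; lra.
pose kap : R := stable_rate x.
have kap0 : 0 < kap by exact: expR_gt0.
pose a (u : R) : R := (1 - al)^-1 * (ln (sin (al * u)) - ln (sin u)).
pose a' (u : R) : R :=
  (1 - al)^-1 * ((sin (al * u))^-1 * (cos (al * u) * al) - (sin u)^-1 * cos u).
pose P (b u : R) : R :=
  kap * (expR (a u + b) * cos u - expR (al * (a u + b)) * cos (al * u)).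
pose Q (b u : R) : R :=
  kap * (expR (a u + b) * sin u - expR (al * (a u + b)) * sin (al * u)).
pose Pb (b u : R) : R :=
  kap * (expR (a u + b) * cos u - al * expR (al * (a u + b)) * cos (al * u)).
pose Qb (b u : R) : R :=
  kap * (expR (a u + b) * sin u - al * expR (al * (a u + b)) * sin (al * u)).
have s0 (u : R) : 0 < u < pi -> 0 < sin u by exact: sin_gt0_pi.
have scl (c u : R) : 0 < c < 1 -> 0 < u < pi -> 0 < c * u < pi.
  move=> /andP[c0 c1] /andP[u0 up]; rewrite mulr_gt0//=.
  by apply: lt_trans up; rewrite gtr_pMl.
have sal (u : R) : 0 < u < pi -> 0 < sin (al * u).
  by move=> u0; apply: s0; exact: scl.
have s1al (u : R) : 0 < u < pi -> 0 < sin ((1 - al) * u).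
  by move=> u0; apply: s0; apply: scl => //; lra.
have da (u : R) : 0 < u < pi -> is_derive u 1 a (a' u).
  by move=> u0; rewrite /a /a'; derive; [exact: sal|exact: s0|ring].
have dPb (b u : R) : 0 < u < pi -> is_derive b 1 (P^~ u) (Pb b u).
  by move=> _; rewrite /P /Pb; derive_ring.
have dQb (b u : R) : 0 < u < pi -> is_derive b 1 (Q^~ u) (Qb b u).
  by move=> _; rewrite /Q /Qb; derive_ring.
have dPu (b u : R) : 0 < u < pi -> is_derive u 1 (P b) (a' u * Pb b u - Qb b u).
  by move=> u0; have h := da u u0; rewrite /P /Pb /Qb; derive_ring.
have dQu (b u : R) : 0 < u < pi -> is_derive u 1 (Q b) (a' u * Qb b u + Pb b u).
  by move=> u0; have h := da u u0; rewrite /Q /Pb /Qb; derive_ring.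
have ca1 (u : R) : 0 < u < pi -> continuous_at u a.
  by move=> u0; have h := da u u0; apply: is_derive_cont; eassumption.
have cP (b u : R) : 0 < u < pi -> continuous_at (b, u) (fun z : R * R => P z.1 z.2).
  by move=> u0; rewrite /P; cont; exact: ca1.
have cQ (b u : R) : 0 < u < pi -> continuous_at (b, u) (fun z : R * R => Q z.1 z.2).
  by move=> u0; rewrite /Q; cont; exact: ca1.
have cPb (b u : R) : 0 < u < pi -> continuous_at (b, u) (fun z : R * R => Pb z.1 z.2).
  by move=> u0; rewrite /Pb; cont; exact: ca1.
have cQb (b u : R) : 0 < u < pi -> continuous_at (b, u) (fun z : R * R => Qb z.1 z.2).
  by move=> u0; rewrite /Qb; cont; exact: ca1.
have ca' (u : R) : 0 < u < pi -> continuous_at u a'.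
  move=> u0; rewrite /a'; cont.
  - by apply: continuous_at_fV; [rewrite lt0r_neq0 ?sal|cont].
  - by apply: continuous_at_fV; [rewrite lt0r_neq0 ?s0|cont].
(* This identity is the vanishing of Q at b = 0; it eliminates expR (a u) in the formulas for P and
   Q. *)
have key (u : R) : 0 < u < pi -> expR (a u) * sin u = expR (al * a u) * sin (al * u).
  move=> u0.
  have {1}-> : a u = al * a u + (ln (sin (al * u)) - ln (sin u)) by rewrite /a; field.
  rewrite expRD expRB !lnK ?posrE ?sal ?s0//.
  by field; rewrite lt0r_neq0 ?s0.
have eq1 (b u : R) : expR (al * (a u + b)) = expR (al * a u) * expR (al * b).
  by rewrite mulrDr expRD.
have eb (b : R) : expR b = expR (al * b) * expR ((1 - al) * b).
  by rewrite -expRD; congr expR; ring.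
have QE (b u : R) : 0 < u < pi -> Q b u =
    kap * (expR (al * a u) * expR (al * b) * sin (al * u) * (expR ((1 - al) * b) - 1)).
  move=> u0; rewrite /Q expRD eq1 mulrAC key// (eb b); ring.
have PE (b u : R) : 0 < u < pi -> P b u = kap * (expR (al * a u) * expR (al * b) *
    (expR ((1 - al) * b) * sin (al * u) * cos u - cos (al * u) * sin u) / sin u).
  move=> u0; rewrite /P expRD eq1 (eb b).
  have -> : expR (a u) = expR (al * a u) * sin (al * u) / sin u.
    by rewrite -key// mulfK// lt0r_neq0 ?s0.
  by field; rewrite lt0r_neq0 ?s0.
have AE (u : R) : zolotarev u = expR (al * a u) * sin ((1 - al) * u) / sin u.
  by rewrite /zolotarev /a; congr (expR _ * _ / _); field.
have P0E (u : R) : 0 < u < pi -> P 0 u = - (kap * zolotarev u).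
  move=> u0; rewrite PE// AE !mulr0 expR0 mul1r mulr1.
  rewrite (_ : (1 - al) * u = u - al * u); last by ring.
  by rewrite sinB; ring.
(* The difference of the two sides is a nonnegative multiple of cos u * (1 - e^((1 - al) b)), whose
   factors have the same sign on each of the two half-strips. *)
have PleA (b u : R) : (b <= 0 /\ 0 < u <= pi / 2) \/ (0 <= b /\ pi / 2 <= u < pi) ->
    P b u <= - (kap * expR (al * b) * zolotarev u).
  move=> h; have u0 : 0 < u < pi by case: h => -[_]; lra.
  rewrite PE// AE -subr_ge0.
  rewrite (_ : _ - _ = kap * expR (al * a u) * expR (al * b) / sin u *
      (sin (al * u) * (cos u * (1 - expR ((1 - al) * b))))); last first.
    rewrite (_ : (1 - al) * u = u - al * u) ?sinB; last by ring.
    by field; rewrite lt0r_neq0 ?s0.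
  apply: mulr_ge0; first by rewrite divr_ge0 ?mulr_ge0 ?expR_ge0 ?(ltW kap0) ?(ltW (s0 _ u0)).
  apply: mulr_ge0; first exact: (ltW (sal _ u0)).
  case: h => -[b0 u2].
    rewrite mulr_ge0 ?cos_ge0_pihalf//; first lra.
    by rewrite subr_ge0 -[leRHS]expR0 ler_expR mulr_ge0_le0//; lra.
  rewrite mulr_le0//.
    rewrite -(subrK (pi / 2) u) cosDpihalf oppr_le0; apply: sin_ge0_pi; lra.
  by rewrite subr_le0 -[leLHS]expR0 ler_expR mulr_ge0//; lra.
have A0 (u : R) : 0 < u < pi -> 0 < zolotarev u.
  by move=> u0; rewrite AE divr_gt0 ?mulr_gt0 ?expR_gt0 ?s1al ?s0.
have Ple0 (b u : R) : b <= 0 -> 0 < u <= pi / 2 -> P b u <= 0.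
  move=> b0 u2; have u0 : 0 < u < pi by lra.
  apply: (le_trans (PleA _ _ (or_introl (conj b0 u2)))).
  by rewrite oppr_le0 mulr_ge0 ?(ltW (A0 _ u0))// mulr_ge0 ?expR_ge0// ltW.
have Q0 (u : R) : 0 < u < pi -> Q 0 u = 0.
  by move=> u0; rewrite QE// mulr0 expR0 mulr0 expR0 subrr !mulr0.
(* A bound for 1 / (zolotarev u * sin u) after the nonpositive term ln (sin u) is dropped from its
   exponent. What is left is continuous up to u = pi, since al u and (1 - al) u stay inside (0,
   pi). *)
have [M hM] : exists M, forall u, pi / 2 <= u <= pi ->
    `|expR (- (al / (1 - al) * ln (sin (al * u)))) / sin ((1 - al) * u)| <= M.
  have [|M hM] := @rect_bounded _ (fun _ u =>
      expR (- (al / (1 - al) * ln (sin (al * u)))) / sin ((1 - al) * u)) 0 0 (pi / 2) pi.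
    move=> z u u2.
    have scl' c : 0 < c < 1 -> 0 < c * u < pi.
      move=> /andP[c0 c1]; rewrite mulr_gt0//=; last lra.
      by apply: (@lt_le_trans _ _ u); [rewrite gtr_pMl//; lra|lra].
    cont; last first.
      by apply: continuous_at_fV; [rewrite lt0r_neq0// s0// scl'//; lra|cont].
    by apply: continuous_ln; rewrite /= s0// scl'.
  by exists M => u u2; apply: (hM 0) => //; rewrite lexx.
have M0 : 0 <= M by apply: le_trans (hM pi _); rewrite ?normr_ge0//; lra.
(* [kap] is for [Qle], M / kap for [expPle]. *)
pose C := kap + M / kap.
have Qle (b u : R) : b <= 0 -> 0 < u <= pi / 2 -> `|Q b u| <= C * sin u * expR (al * b).
  move=> b0 u2; have u0 : 0 < u < pi by lra.
  have su := s0 _ u0.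
  have slu : sin (al * u) <= sin u.
    have alu : al * u <= u by rewrite ler_piMl//; lra.
    have alu0 : 0 < al * u by rewrite mulr_gt0//; lra.
    have [->//|nu] := eqVneq (al * u) u.
    apply: ltW; rewrite ltr_sin ?in_itv/=; [|lra|lra].
    by rewrite lt_neqAle nu.
  have au0 : al * a u <= 0.
    rewrite pmulr_rle0// /a pmulr_rle0 ?invr_gt0; last lra.
    by rewrite subr_le0 ler_ln ?posrE ?sal ?s0.
  rewrite QE// !normrM (gtr0_norm kap0) !(ger0_norm (expR_ge0 _)) (gtr0_norm (sal _ u0)).
  have e1 : `|expR ((1 - al) * b) - 1| <= 1.
    have := expR_ge0 ((1 - al) * b).
    have : expR ((1 - al) * b) <= 1 by rewrite -[leRHS]expR0 ler_expR mulr_ge0_le0//; lra.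
    by rewrite ler_norml; lra.
  rewrite (@le_trans _ _ (kap * (1 * expR (al * b) * sin u * 1)))//.
    rewrite ler_pM2l// ler_pM ?mulr_ge0 ?expR_ge0 ?(ltW (sal _ u0))//.
    rewrite ler_pM ?mulr_ge0 ?expR_ge0 ?(ltW (sal _ u0))//.
    by rewrite ler_pM2r ?expR_gt0// -[leRHS]expR0 ler_expR.
  rewrite (_ : kap * _ = kap * sin u * expR (al * b)); last by ring.
  rewrite ler_pM2r ?expR_gt0// ler_pM2r// /C lerDl.
  by rewrite divr_ge0// ltW.
have P_cvg0 (u : R) : 0 < u <= pi / 2 -> P (- n%:R) u @[n --> \oo] --> 0.
  move=> u2; rewrite /P.
  have -> : nbhs (0 : R) = nbhs (kap * (expR (a u) * 0 * cos u -
      expR (al * a u) * 0 * cos (al * u))) by rewrite !(mulr0, mul0r) subrr mulr0.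
  apply: cvgM; first exact: cvg_cst.
  apply: cvgB; (apply: cvgM; last exact: cvg_cst).
    under eq_fun do rewrite expRD.
    by apply: cvgM; [exact: cvg_cst|exact: cvgn_expR].
  under eq_fun do rewrite eq1 mulrN.
  by apply: cvgM; [exact: cvg_cst|exact: cvgn_expRN].
have expPle (b u : R) : 0 <= b -> pi / 2 <= u < pi ->
    expR (P b u) <= C * sin u * expR (- (al * b)).
  move=> b0 u2; have u0 : 0 < u < pi by lra.
  have su := s0 _ u0; have Au := A0 _ u0.
  have K0 : 0 < kap * expR (al * b) * zolotarev u by rewrite mulr_gt0// mulr_gt0// expR_gt0.
  rewrite (@le_trans _ _ (kap * expR (al * b) * zolotarev u)^-1)//.
    rewrite (le_trans (_ : _ <= expR (- (kap * expR (al * b) * zolotarev u))))//.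
      by rewrite ler_expR; apply: PleA; right.
    rewrite expRN lef_pV2 ?posrE ?expR_gt0//.
    by have := expR_ge1Dx (kap * expR (al * b) * zolotarev u); lra.
  have hMu := hM u (_ : pi / 2 <= u <= pi).
  have AV : (zolotarev u)^-1 <= M * sin u.
    rewrite -ler_pdivrMr//; apply: le_trans (hMu _); last lra.
    rewrite ger0_norm ?divr_ge0 ?expR_ge0 ?(ltW (s1al _ u0))//.
    rewrite AE (_ : _ / sin u = expR (- (al * a u)) / sin ((1 - al) * u)); last first.
      by rewrite expRN; field; rewrite ?expR_eq0 ?(lt0r_neq0 su) ?(lt0r_neq0 (s1al _ u0)).
    rewrite ler_pM2r ?invr_gt0 ?s1al// ler_expR lerN2 /a.
    rewrite mulrA ler_pM2l ?divr_gt0//; last lra.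
    rewrite lerDl oppr_ge0; apply: ln_le0; exact: sin_le1.
  rewrite (_ : (_ * _)^-1 = kap^-1 * (zolotarev u)^-1 * expR (- (al * b))); last first.
    by rewrite expRN; field; rewrite ?expR_eq0 ?(lt0r_neq0 kap0) ?(lt0r_neq0 Au).
  rewrite ler_pM2r ?expR_gt0//.
  rewrite (@le_trans _ _ (kap^-1 * (M * sin u)))//; first by rewrite ler_pM2l ?invr_gt0.
  rewrite mulrA ler_pM2r// mulrC /C lerDr; exact: ltW.
have i0 := contour_integrable al0 dPb dQb Ple0 Qle expPle.
have I0 := contour_integral al0 dPb dQb dPu dQu cP cQ cPb cQb ca' Q0 Ple0 Qle P_cvg0 expPle.
have cf : continuous (fun b => expR (P b (pi / 2)) * sin (Q b (pi / 2))).
  by move=> b; rewrite /P /Q; cont.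
(* Chosen so that, after the shift, kap e^(al z) becomes e^(al b) at height pi/2 up to its phase;
   then kap e^z becomes x e^b, by the exponent in [stable_rate]. *)
pose c := a (pi / 2) - (1 - al)^-1 * ln x.
have [i1 I1] := Rintegral_shift c cf i0.
have SE (b : R) : stable_sine b (- x) =
    expR (P (b - c) (pi / 2)) * sin (Q (b - c) (pi / 2)).
  rewrite /stable_sine /P /Q sin_pihalf cos_pihalf.
  have e1 : kap * expR (al * (a (pi / 2) + (b - c))) = expR (al * b).
    by rewrite /kap /stable_rate -expRD; congr expR; rewrite /c; field.
  have e2 : kap * expR (a (pi / 2) + (b - c)) = x * expR b.
    rewrite -[x in RHS]lnK ?posrE// /kap /stable_rate -!expRD; congr expR; rewrite /c; field.
    exact: al1'.
  congr (expR _ * sin _); first by rewrite -e1; ring.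
  by rewrite mulNr mulrN opprK mulrC -e2 -e1; ring.
split; first by apply: eq_integrable i1 => // b _; rewrite /= SE.
under eq_Rintegral do rewrite SE.
rewrite I1 I0; congr (_ - _); apply: eq_Rintegral => u.
by rewrite inE/= in_itv/= => u0; rewrite P0E.
Qed.

End stable.

(** * Monotonicity of Zolotarev's function *)

Section monotone.
Context {R : realType}.

Lemma MVT_is_derive (f f' : R -> R) (a b : R) : a < b ->
  (forall x, a <= x <= b -> is_derive x 1 f (f' x)) ->
  exists2 c, a < c < b & f b - f a = f' c * (b - a).
Proof.
move=> ab df.
have h x : x \in `]a, b[%R -> is_derive x 1 f (f' x).
  by rewrite in_itv/= => /andP[? ?]; apply: df; rewrite !ltW.
have cf : {within `[a, b], continuous f}.
  apply: continuous_in_subspaceT => x; rewrite inE/= in_itv/= => x0.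
  by have d := df x x0; apply: is_derive_cont; eassumption.
have [c + E] := @MVT _ f f' a b ab h cf.
by rewrite in_itv/= => c0; exists c.
Qed.

Lemma derive_le0_nonincreasing (f f' : R -> R) (a b : R) :
  (forall x, a < x < b -> is_derive x 1 f (f' x)) ->
  (forall x, a < x < b -> f' x <= 0) ->
  forall x y, a < x -> x <= y -> y < b -> f y <= f x.
Proof.
move=> df f0 x y ax; rewrite le_eqVlt => /predU1P[->//|xy] yb.
have dfxy z : x <= z <= y -> is_derive z 1 f (f' z).
  by move=> z0; apply: df; lra.
have [c c0 E] := MVT_is_derive xy dfxy.
have : f' c * (y - x) <= 0 by rewrite mulr_le0_ge0//; [apply: f0; lra|lra].
lra.
Qed.

Lemma mulr_cos_le_sin (u : R) : 0 < u < pi -> u * cos u <= sin u.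
Proof.
move=> /andP[u0 up].
have [c c0] := @MVT_is_derive (fun u => sin u - u * cos u) (fun u => u * sin u) 0 u u0
  (fun x _ => ltac:(derive_ring)).
rewrite /= sin0 mul0r !subr0 => E.
have : 0 <= c * sin c * u.
  by rewrite !mulr_ge0//; [lra|apply: ltW; apply: sin_gt0_pi; lra|lra].
lra.
Qed.

Lemma sin_le_id (u : R) : 0 < u -> sin u <= u.
Proof.
by move=> u0; rewrite (le_trans (ler_norm _))// (le_trans (normr_sin_le _))// gtr0_norm.
Qed.

Definition lnsinc (u : R) : R := ln (sin u) - ln u.
(** The derivative of u * lnsinc u, not that of [lnsinc]. *)
Definition dlnsinc (u : R) : R := lnsinc u + u * cos u / sin u - 1.

Lemma is_derive_lnsinc (u : R) : 0 < u < pi ->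
  is_derive u 1 lnsinc (cos u / sin u - u^-1).
Proof.
move=> u0; have s0 := sin_gt0_pi u0; have up : 0 < u by case/andP: u0.
have h := is_derive_fD (is_derive_fln s0 (is_derive_sin u)) (is_derive_fN (is_derive1_ln up)).
by notypeclasses refine (is_derive_congr h _); ring.
Qed.

Lemma lnsinc_nonincreasing (u v : R) : 0 < u -> u <= v -> v < pi -> lnsinc v <= lnsinc u.
Proof.
apply: derive_le0_nonincreasing => x x0; first exact: is_derive_lnsinc.
have s0 := sin_gt0_pi x0; have xp : 0 < x by case/andP: x0.
have h := mulr_cos_le_sin x0.
rewrite subr_le0 ler_pdivrMr// mulrC ler_pdivlMr// mulrC//.
Qed.

Lemma lnsinc_le0 (u : R) : 0 < u < pi -> lnsinc u <= 0.
Proof.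
move=> u0; have s0 := sin_gt0_pi u0; have up : 0 < u by case/andP: u0.
by rewrite /lnsinc subr_le0 ler_ln ?posrE// sin_le_id.
Qed.

(** The derivative is minus a sum of two squares divided by u sin^2 u. *)
Lemma dlnsinc_nonincreasing (u v : R) : 0 < u -> u <= v -> v < pi -> dlnsinc v <= dlnsinc u.
Proof.
pose f (u : R) : R := cos u / sin u - u^-1 +
  (u * cos u * (- cos u / sin u ^+ 2) + (sin u)^-1 * (u * - sin u + cos u)).
apply: (@derive_le0_nonincreasing _ f) => x x0.
  have s0 := sin_gt0_pi x0; have h := is_derive_lnsinc x0.
  by rewrite /dlnsinc /f; derive; [exact: lt0r_neq0|ring].
have s0 := sin_gt0_pi x0; have xp : 0 < x by case/andP: x0.
rewrite (_ : f x = - ((sin x - x * cos x) ^+ 2 + (x * sin x) ^+ 2) / (x * sin x ^+ 2)).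
  rewrite mulNr oppr_le0 divr_ge0 ?addr_ge0 ?sqr_ge0//.
  by rewrite mulr_ge0 ?sqr_ge0// ltW.
rewrite /f; apply/eqP; rewrite -subr_eq0; apply/eqP.
field; rewrite ?(lt0r_neq0 s0) ?(lt0r_neq0 xp)//.
Qed.

Definition ln_zolotarev (al u : R) : R :=
  (al * lnsinc (al * u) - lnsinc u) / (1 - al) + lnsinc ((1 - al) * u).
Definition ln_zolotarev_S (u : R) : R := - dlnsinc u.

(* [x * lnsinc (x * u)] has the nonincreasing derivative [dlnsinc (x * u)], hence
   is concave in x; [ln_zolotarev al u] is, up to [lnsinc ((1 - al) * u)], minus
   its slope between al and 1, whose limit at al = 1 is [ln_zolotarev_S u]. *)
Lemma slope_lnsinc (al be u : R) : 0 < al -> al < be -> be <= 1 -> 0 < u < pi ->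
  exists2 c, al < c < be &
  be * lnsinc (be * u) - al * lnsinc (al * u) = dlnsinc (c * u) * (be - al).
Proof.
move=> al0 albe be1 u0.
apply: (@MVT_is_derive (fun x => x * lnsinc (x * u)) (fun x => dlnsinc (x * u))) => // x x0.
have x1 : 0 < x * u < pi.
  rewrite mulr_gt0; [|lra|lra]; rewrite (@le_lt_trans _ _ u)//; last lra.
  by rewrite ler_piMl//; lra.
have h : is_derive x 1 (fun x => lnsinc (x * u)) ((cos (x * u) / sin (x * u) - (x * u)^-1) * u).
  have h1 : is_derive x 1 (fun x : R => x * u) u by derive_ring.
  by have := @is_derive1_comp _ lnsinc (fun x : R => x * u) x _ _ (is_derive_lnsinc x1) h1.
have s0 := sin_gt0_pi x1.
derive; rewrite /dlnsinc; field.
by rewrite ?(lt0r_neq0 s0) lt0r_neq0 ?lt0r_neq0//; lra.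
Qed.

(** By concavity the slope of x * lnsinc (x u) over [be, 1] is at most the one over [al, be], hence
    at most the one over [al, 1]; the fraction in [ln_zolotarev] is minus that slope. The remaining
    term increases because (1 - al) u decreases. *)
Lemma ln_zolotarev_le (al be u : R) : 0 < al -> al < be -> be < 1 -> 0 < u < pi ->
  ln_zolotarev al u <= ln_zolotarev be u.
Proof.
move=> al0 albe be1 u0.
have [c1 c10 E1] := slope_lnsinc al0 albe (ltW be1) u0.
have [c2 c20] := slope_lnsinc (lt_trans al0 albe) be1 (lexx 1) u0.
rewrite !mul1r => E2.
have k12 : dlnsinc (c2 * u) <= dlnsinc (c1 * u).
  apply: dlnsinc_nonincreasing.
  - by rewrite mulr_gt0; lra.
  - by rewrite ler_pM2r; lra.
  - by rewrite (@lt_trans _ _ u)//; [rewrite gtr_pMl; lra|lra].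
rewrite /ln_zolotarev lerD//; last first.
  apply: lnsinc_nonincreasing.
  - by rewrite mulr_gt0; lra.
  - by rewrite ler_pM2r; lra.
  - by rewrite (@lt_trans _ _ u)//; [rewrite gtr_pMl; lra|lra].
rewrite ler_pdivrMr; last lra.
rewrite (_ : be * _ - _ = - dlnsinc (c2 * u) * (1 - be)); last lra.
rewrite mulfK; last by rewrite lt0r_neq0//; lra.
have := ler_wpM2r (_ : 0 <= be - al) k12; lra.
Qed.

(** The slope over [al, 1] is dlnsinc (c u) with c < 1, hence at least dlnsinc u, and the remaining
    term is nonpositive. *)
Lemma ln_zolotarev_le_ln_zolotarev_S (al u : R) : 0 < al -> al < 1 -> 0 < u < pi ->
  ln_zolotarev al u <= ln_zolotarev_S u.
Proof.
move=> al0 al1 u0.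
have [c c0] := slope_lnsinc al0 al1 (lexx 1) u0.
rewrite !mul1r => E.
have k12 : dlnsinc u <= dlnsinc (c * u).
  apply: dlnsinc_nonincreasing.
  - by rewrite mulr_gt0; lra.
  - by rewrite ler_piMl; lra.
  - lra.
rewrite /ln_zolotarev (_ : al * _ - _ = - dlnsinc (c * u) * (1 - al)); last lra.
rewrite mulfK; last by rewrite lt0r_neq0//; lra.
have : lnsinc ((1 - al) * u) <= 0.
  apply: lnsinc_le0; rewrite mulr_gt0; [|lra|lra].
  by rewrite (@lt_trans _ _ u)//; [rewrite gtr_pMl; lra|lra].
rewrite /ln_zolotarev_S; lra.
Qed.

(** Once - lnsinc u is split off from the fraction, only differences lnsinc (c u) - lnsinc u with c
    < 1 remain, with nonnegative coefficients. *)
Lemma ln_zolotarev_ge0 (al u : R) : 0 < al -> al < 1 -> 0 < u < pi -> 0 <= ln_zolotarev al u.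
Proof.
move=> al0 al1 u0.
have dec c : 0 < c < 1 -> lnsinc u <= lnsinc (c * u).
  move=> c01; apply: lnsinc_nonincreasing.
  - by rewrite mulr_gt0; lra.
  - by rewrite ler_piMl; lra.
  - lra.
have h1 := dec al (introT andP (conj al0 al1)).
have h2 : lnsinc u <= lnsinc ((1 - al) * u) by apply: dec; lra.
rewrite /ln_zolotarev (_ : (_ - _) / _ = al / (1 - al) * (lnsinc (al * u) - lnsinc u) - lnsinc u).
  have : 0 <= al / (1 - al) * (lnsinc (al * u) - lnsinc u).
    by rewrite mulr_ge0 ?divr_ge0//; lra.
  lra.
by field; rewrite lt0r_neq0//; lra.
Qed.

Lemma ln_zolotarev_S_ge0 (u : R) : 0 < u < pi -> 0 <= ln_zolotarev_S u.
Proof.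
move=> u0; apply: (le_trans (@ln_zolotarev_ge0 2^-1 u _ _ u0)); [lra|lra|].
by apply: ln_zolotarev_le_ln_zolotarev_S => //; lra.
Qed.

Lemma zolotarev_S_expR (u : R) : 0 < u < pi -> zolotarev_S u = expR (ln_zolotarev_S u).
Proof.
move=> u0; have s0 := sin_gt0_pi u0; have up : 0 < u by case/andP: u0.
rewrite /zolotarev_S /ln_zolotarev_S /dlnsinc /lnsinc.
rewrite [X in _ = expR X](_ : _ = (1 - u * cos u / sin u) + (ln u - ln (sin u))); last by ring.
by rewrite [RHS]expRD expRB !lnK ?posrE// mulrA.
Qed.

(** The constant is al^(al / (1 - al)) (1 - al), the limit of Zolotarev's function at u = 0; passing
    from sin to sin u / u changes nothing else, as the powers of u cancel. *)
Lemma zolotarev_expR (al u : R) : 0 < al -> al < 1 -> 0 < u < pi ->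
  zolotarev al u = expR (al * ln al / (1 - al) + ln (1 - al)) * expR (ln_zolotarev al u).
Proof.
move=> al0 al1 u0; have s0 := sin_gt0_pi u0; have up : 0 < u by case/andP: u0.
have c0 : 0 < 1 - al by lra.
have s1 : 0 < sin ((1 - al) * u).
  apply: sin_gt0_pi; rewrite mulr_gt0//=.
  by rewrite (@lt_trans _ _ u)//; [rewrite gtr_pMl; lra|lra].
rewrite /zolotarev -[sin ((1 - al) * u)]lnK ?posrE// -[X in _ / X]lnK ?posrE//.
rewrite -expRN -!expRD; congr expR.
rewrite /ln_zolotarev /lnsinc !lnM ?posrE//.
by field; rewrite lt0r_neq0.
Qed.

End monotone.

(** * Medians *)

Section measurable_kernels.
Context {R : realType}.

Lemma measurable_zolotarev (al : R) : 0 < al < 1 -> measurable_fun `]0, pi[ (zolotarev al).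
Proof.
move=> al01; apply: continuous_at_measurable => // u; rewrite /= in_itv/= => u0.
have s0 := sin_gt0_pi u0.
have s1 : 0 < sin (al * u).
  apply: sin_gt0_pi; rewrite mulr_gt0; [|lra|lra].
  by rewrite (@lt_trans _ _ u)//; [rewrite gtr_pMl; lra|lra].
rewrite /zolotarev; cont.
- exact: continuous_ln.
- exact: continuous_ln.
- by apply: inv_continuous; rewrite /= lt0r_neq0.
Qed.

Lemma measurable_zolotarev_S : measurable_fun `]0, pi[ (@zolotarev_S R).
Proof.
apply: continuous_at_measurable => // u; rewrite /= in_itv/= => u0.
have s0 := sin_gt0_pi u0.
by rewrite /zolotarev_S; cont; apply: inv_continuous; rewrite /= lt0r_neq0.
Qed.

End measurable_kernels.

Section laws.
Context d {T : measurableType d} {R : realType} (P : probability T R).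
Notation mu := (@lebesgue_measure R).

Lemma ae_eq_Rintegral (f g : T -> R) : measurable_fun setT f -> measurable_fun setT g ->
  (\forall w \ae P, f w = g w) -> \int[P]_w f w = \int[P]_w g w.
Proof.
move=> mf mg fg; rewrite /Rintegral; congr fine; apply: ae_eq_integral => //.
- exact/measurable_EFinP.
- exact/measurable_EFinP.
- by apply: filterS fg => w -> _.
Qed.

Lemma stable_rate_cvg0 (al m : R) : 0 < al < 1 -> stable_rate al (m + n%:R) @[n --> \oo] --> 0.
Proof.
move=> al01; have c0 : 0 < al / (1 - al) by rewrite divr_gt0//; lra.
have lny : (fun n => al / (1 - al) * ln (m + n%:R)) @ \oo --> +oo.
  apply/cvgryPge => A; near=> n.
  rewrite mulrC -ler_pdivrMr// -(@expRK R (A / _)) ler_ln ?posrE ?expR_gt0//.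
    by rewrite -lerBlDl; near: n; exact: nbhs_infty_ger.
  by rewrite -ltrBlDl; near: n; exact: nbhs_infty_gtr.
exact: (cvg_comp _ _ lny (@cvgr_expR R)).
Unshelve. all: end_near. Qed.

Lemma positive_stable_median (al m : R) (Z : {RV P >-> R}) : 0 < al < 1 ->
  is_positive_stable al Z -> is_median P Z m ->
  0 < m /\ \int[mu]_(u in `]0, pi[) expR (- (stable_rate al m * zolotarev al u)) = pi / 2.
Proof.
move=> al01 [Z0 hZ] med.
have m0 : 0 < m.
  rewrite ltNge; apply/negP => mle0; case: med => + _.
  have [N [mN N0 ZN]] := Z0.
  have mle : measurable [set w | Z w <= m].
    rewrite (_ : [set w | _] = Z @^-1` `]-oo, m]%classic); first exact: measurable_funPTI.
    by apply/seteqP; split => w /=; rewrite in_itv.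
  have : (P [set w | (Z w <= m)%R] <= P N)%E.
    apply: le_measure; rewrite ?inE// => w /= Zw; apply: ZN => /= Zw0.
    by have := lt_le_trans Zw0 (le_trans Zw mle0); rewrite ltxx.
  rewrite N0 => + E; rewrite E lee_fin; lra.
split=> //.
have mZ : measurable_fun setT Z by [].
(* [Z] is only almost surely positive, hence the absolute value. *)
have mnZ : measurable_fun setT (fun w => `|Z w|) by exact: measurableT_comp.
have E l : 0 <= l -> \int[P]_w expR (- (l * `|Z w|)) = expR (- (l `^ al)).
  move=> l0; have := hZ l l0; rewrite unlock => hl.
  rewrite -[RHS]/(fine (expR (- (l `^ al)))%:E) -hl.
  apply: ae_eq_Rintegral.
  - by apply: measurable_fexp; apply: measurable_funN; exact: measurable_funM.
  - by apply: measurable_fexp; apply: measurable_funN; exact: measurable_funM.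
  - by apply: filterS Z0 => w Zw; rewrite gtr0_norm.
(* The sign is dictated by the passage of y to -oo: the stable formula holds for x = - y > 0, and
   every y <= - m satisfies this, whereas going down from m itself would leave the half-line. *)
pose Y : {RV P >-> R} := (- (Z : {mfun T >-> R})).
have hS b y : \int[P]_w sin (expR b * (Y w - y)) = stable_sine al b y.
  rewrite /stable_sine -(laplace_sin_ge0 _ _ mnZ (fun _ => normr_ge0 _) al01 E).
  apply: ae_eq_Rintegral.
  - by apply: measurable_fsin; apply: measurable_funM => //; exact: measurable_funB.
  - by apply: measurable_fsin; apply: measurable_funB => //; exact: measurable_funM.
  - by apply: filterS Z0 => w Zw; rewrite gtr0_norm// (_ : Y w = - Z w)//; congr sin; ring.
have SZI y : y < 0 -> mu.-integrable setT (EFin \o (stable_sine al)^~ y) /\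
    \int[mu]_b stable_sine al b y =
    \int[mu]_(u in `]0, pi[) expR (- (stable_rate al (- y) * zolotarev al u)) - pi / 2.
  by move=> y0; have := @stable_sine_integral _ _ al01 (- y); rewrite opprK; apply; lra.
rewrite -[m in stable_rate al m]opprK.
apply: (@median_equation _ _ _ P Y (stable_sine al)
  (fun y => stable_rate al (- y)) (zolotarev al) (- m)) => //.
- by move=> y ym; apply: (SZI y _).1; lra.
- by move=> y ym; apply: (SZI y _).2; lra.
- by move=> y _; exact: expR_ge0.
- rewrite (_ : (fun n => _) = (fun n => stable_rate al (m + n%:R))); first exact: stable_rate_cvg0.
  by apply/funext => n; rewrite opprB opprK addrC.
- exact: measurable_zolotarev.
- move=> u u0; case/andP: al01 => al0 al1.
  by rewrite zolotarev_expR// mulr_ge0 ?expR_ge0.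
- case: med => h1 h2; split.
    by rewrite -h2; congr (P _); apply/seteqP; split => w /=; rewrite /Y /= lerN2.
  by rewrite -h1; congr (P _); apply/seteqP; split => w /=; rewrite /Y /= lerN2.
Qed.

Lemma log_S_median (m : R) (X : {RV P >-> R}) :
  is_log_S X -> is_median P (fun w => expR (X w)) m ->
  0 < m /\ \int[mu]_(u in `]0, pi[) expR (- (m * zolotarev_S u)) = pi / 2.
Proof.
move=> hX med.
have m0 : 0 < m.
  rewrite ltNge; apply/negP => mle0; case: med => + _.
  rewrite (_ : [set w | _] = set0) ?measure0; last first.
    apply/seteqP; split => w //= Xm.
    by have := lt_le_trans (expR_gt0 (X w)) (le_trans Xm mle0); rewrite ltxx.
  by move=> /eqP; rewrite eqe; lra.
split=> //.
have icst (c : R) : P.-integrable setT (EFin \o (fun=> c)).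
  exact: finite_measure_integrable_cst.
have hcs (l : R) : 0 < l ->
    \int[P]_w cos (l * X w) = expR (- (pi * l / 2)) * cos (l * (ln l - 1)) /\
    \int[P]_w sin (l * X w) = expR (- (pi * l / 2)) * sin (l * (ln l - 1)).
  move=> l0; have := hX l; rewrite /char_fun /cexpectation /cexp !unlock /=.
  rewrite !(mul0r, mulr0, mul1r, subr0, sub0r, addr0, add0r, oppr0) (gtr0_norm l0) => -[h1 h2].
  split.
    rewrite -h1; apply: eq_Rintegral => w _.
    by rewrite !(mul0r, mulr0, mul1r, subr0, sub0r, addr0, add0r, oppr0, expR0).
  rewrite -h2; apply: eq_Rintegral => w _.
  by rewrite !(mul0r, mulr0, mul1r, subr0, sub0r, addr0, add0r, oppr0, expR0).
have icos l : P.-integrable setT (EFin \o (fun w => cos (l * X w))).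
  apply: (le_integrable measurableT _ _ (icst 1)).
    apply/measurable_EFinP.
    apply: (measurableT_comp (continuous_measurable_fun (@continuous_cos R))).
    exact: measurable_funM.
  by move=> w _ /=; rewrite lee_fin normr1 cos_max.
have isin l : P.-integrable setT (EFin \o (fun w => sin (l * X w))).
  apply: (le_integrable measurableT _ _ (icst 1)).
    by apply/measurable_EFinP; apply: measurable_fsin; exact: measurable_funM.
  by move=> w _ /=; rewrite lee_fin normr1 sin_max.
have hS b y : \int[P]_w sin (expR b * (X w - y)) = logS_sine b y.
  have [h1 h2] := hcs (expR b) (expR_gt0 b).
  transitivity (\int[P]_w (cos (expR b * y) * sin (expR b * X w) -
      sin (expR b * y) * cos (expR b * X w))).
    by apply: eq_Rintegral => w _; rewrite mulrBr sinB; ring.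
  rewrite RintegralB//; last 2 first.
  - exact: (integrableZl measurableT _ (isin _)).
  - exact: (integrableZl measurableT _ (icos _)).
  rewrite RintegralZl// RintegralZl// h1 h2 expRK /logS_sine.
  have -> : expR b * (b - 1 - y) = expR b * (b - 1) - expR b * y by ring.
  have -> : pi / 2 * expR b = pi * expR b / 2 by ring.
  by rewrite sinB; ring.
rewrite (_ : m = expR (ln m)); last by rewrite lnK ?posrE.
apply: (@median_equation _ _ _ P X logS_sine expR zolotarev_S (ln m)) => //.
- by move=> y ym; exact: (logS_sine_integral y).1.
- by move=> y ym; exact: (logS_sine_integral y).2.
- under eq_fun do rewrite expRD.
  rewrite -(mulr0 (expR (ln m))); apply: cvgM; [exact: cvg_cst|exact: cvgn_expR].
- exact: measurable_zolotarev_S.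
- by move=> u u0; rewrite zolotarev_S_expR// expR_ge0.
- have key : forall w, (X w <= ln m) = (expR (X w) <= m) /\ (ln m <= X w) = (m <= expR (X w)).
    by move=> w; split; rewrite -[RHS]ler_ln ?posrE ?expR_gt0// expRK.
  case: med => h1 h2; split.
    by rewrite -h1; congr (P _); apply/seteqP; split => w /=; rewrite (key w).1.
  by rewrite -h2; congr (P _); apply/seteqP; split => w /=; rewrite (key w).2.
Qed.

End laws.

(** * Comparison of the weights and growth of the medians *)

Section comparison.
Context {R : realType}.
Notation mu := (@lebesgue_measure R).

(** If w < w', then w' B >= w' A >= w A + (w' - w) because A >= 1, so that c <= exp (- (w' - w)) c,
    which is absurd. The lower bound 1 yields a uniform gain, so no strict inequality between
    integrals is involved. *)
Lemma scale_antitone (A B : R -> R) (w w' c : R) :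
  measurable_fun `]0, pi[ A -> measurable_fun `]0, pi[ B ->
  (forall u, 0 < u < pi -> 1 <= A u <= B u) -> 0 <= w -> 0 < c ->
  \int[mu]_(u in `]0, pi[) expR (- (w * A u)) = c ->
  \int[mu]_(u in `]0, pi[) expR (- (w' * B u)) = c -> w' <= w.
Proof.
move=> mA mB AB w0 c0 EA EB; rewrite leNgt; apply/negP => ww'.
have mI : measurable (`]0, pi[%classic : set (measurableTypeR R)) by exact: measurable_itv.
have iexp (F : R -> R) v : measurable_fun `]0, pi[ F -> (forall u, 0 < u < pi -> 0 <= F u) ->
    0 <= v -> mu.-integrable `]0, pi[ (EFin \o (fun u => expR (- (v * F u)))).
  move=> mF F0 v0; apply: (@bounded_itv_integrable _ _ _ 0 pi 1) => //.
  - by move=> u /=; rewrite !in_itv/= => /andP[u0 up]; rewrite !ltW.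
  - by apply: (measurableT_comp (@measurable_expR R)); apply: measurable_funN;
      apply: measurable_funM.
  - move=> u /=; rewrite in_itv/= => u0; rewrite ger0_norm ?expR_ge0// -expR0 ler_expR.
    by rewrite oppr_le0 mulr_ge0//; exact: F0.
have iA := iexp A w mA (fun u u0 => ltac:(have := AB u u0; lra)) w0.
have iB := iexp B w' mB (fun u u0 => ltac:(have := AB u u0; lra)) ltac:(lra).
have : c <= expR (- (w' - w)) * c.
  rewrite -[leLHS]EB -[in leRHS]EA -RintegralZl//.
  apply: le_Rintegral => //; first exact: (integrableZl mI _ iA).
  move=> u /=; rewrite in_itv/= => /AB u0; rewrite -expRD ler_expR.
  have h1 : w' * A u <= w' * B u by rewrite ler_wpM2l//; lra.
  have h2 : (w' - w) * 1 <= (w' - w) * A u by rewrite ler_wpM2l//; lra.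
  lra.
by rewrite leNgt gtr_pMl// -expR0 ltr_expR oppr_lt0 subr_gt0 ww'.
Qed.

(* Normalised so that the function it multiplies, [expR (ln_zolotarev al u)], is
   at least 1. *)
Definition stable_weight (al x : R) : R :=
  stable_rate al x * expR (al * ln al / (1 - al) + ln (1 - al)).

Lemma stable_weight_gt0 (al x : R) : 0 < stable_weight al x.
Proof. by rewrite mulr_gt0 ?expR_gt0. Qed.

Lemma ln_stable_weight (al x : R) : 0 < al < 1 -> 0 < x ->
  ln x = ln al + (1 - al) / al * (ln (1 - al) - ln (stable_weight al x)).
Proof.
move=> al01 x0; rewrite /stable_weight /stable_rate -expRD expRK.
by field; rewrite !lt0r_neq0//; lra.
Qed.

Lemma stable_weight_integral (al x : R) : 0 < al < 1 ->
  \int[mu]_(u in `]0, pi[) expR (- (stable_rate al x * zolotarev al u)) =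
  \int[mu]_(u in `]0, pi[) expR (- (stable_weight al x * expR (ln_zolotarev al u))).
Proof.
case/andP=> al0 al1; apply: eq_Rintegral => u; rewrite inE/= in_itv/= => u0.
by rewrite zolotarev_expR// mulrA.
Qed.

Lemma measurable_expR_ln_zolotarev (al : R) : 0 < al < 1 ->
  measurable_fun `]0, pi[ (fun u => expR (ln_zolotarev al u)).
Proof.
move=> al01.
pose k := expR (al * ln al / (1 - al) + ln (1 - al)).
apply: (eq_measurable_fun (fun u => k^-1 * zolotarev al u)).
  move=> u; rewrite inE/= in_itv/= => u0; case/andP: al01 => al0 al1.
  by rewrite zolotarev_expR// mulKf// lt0r_neq0// expR_gt0.
by apply: measurable_funM => //; exact: measurable_zolotarev.
Qed.

Lemma stable_weight_antitone (al be x y : R) : 0 < al -> al < be -> be < 1 ->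
  \int[mu]_(u in `]0, pi[) expR (- (stable_rate al x * zolotarev al u)) = pi / 2 ->
  \int[mu]_(u in `]0, pi[) expR (- (stable_rate be y * zolotarev be u)) = pi / 2 ->
  stable_weight be y <= stable_weight al x.
Proof.
move=> al0 albe be1.
have al01 : 0 < al < 1 by lra.
have be01 : 0 < be < 1 by lra.
have p0 : 0 < pi / 2 :> R by rewrite divr_gt0 ?pi_gt0.
rewrite (stable_weight_integral _ al01) (stable_weight_integral _ be01).
apply: scale_antitone => //.
- exact: measurable_expR_ln_zolotarev.
- exact: measurable_expR_ln_zolotarev.
- move=> u u0; rewrite -expR0 !ler_expR ln_zolotarev_le// andbT.
  by apply: ln_zolotarev_ge0 => //; case/andP: al01.
- exact/ltW/stable_weight_gt0.
Qed.

Lemma le_stable_weight (be y w : R) : 0 < be -> be < 1 ->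
  \int[mu]_(u in `]0, pi[) expR (- (stable_rate be y * zolotarev be u)) = pi / 2 ->
  \int[mu]_(u in `]0, pi[) expR (- (w * zolotarev_S u)) = pi / 2 ->
  w <= stable_weight be y.
Proof.
move=> be0 be1.
have be01 : 0 < be < 1 by rewrite be0 be1.
have p0 : 0 < pi / 2 :> R by rewrite divr_gt0 ?pi_gt0.
rewrite (stable_weight_integral _ be01); apply: scale_antitone => //.
- exact: measurable_expR_ln_zolotarev.
- exact: measurable_zolotarev_S.
- by move=> u u0; rewrite zolotarev_S_expR// -expR0 !ler_expR ln_zolotarev_ge0//
    ln_zolotarev_le_ln_zolotarev_S.
- exact/ltW/stable_weight_gt0.
Qed.

(** Comparison with the constant function 1, whose scale ln 2 solves pi exp (- w) = pi / 2. Applied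
    to m_S, it places the interval (1 - m_S, 1) inside (0, 1). *)
Lemma scale_zolotarev_S_le1 (w : R) :
  \int[mu]_(u in `]0, pi[) expR (- (w * zolotarev_S u)) = pi / 2 -> w <= 1.
Proof.
move=> E; have ln2 : 0 <= ln (2 : R) <= 1.
  rewrite ln_ge0 ?ler1n//= (_ : 2 = 1 + 1 :> R)//; by rewrite le_ln1Dx//; lra.
case/andP: ln2 => ln20 ln21; apply: le_trans ln21.
apply: (@scale_antitone (fun=> 1) zolotarev_S _ _ (pi / 2)) => //.
- exact: measurable_zolotarev_S.
- by move=> u u0; rewrite zolotarev_S_expR// lexx -expR0 ler_expR ln_zolotarev_S_ge0.
- by have := pi_gt0 R; lra.
- rewrite Rintegral_cst//.
  have := @lebesgue_measure_itv R `]0, pi[.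
  rewrite /= lte_fin pi_gt0 => ->.
  by rewrite mulr1 expRN lnK ?posrE// -EFinB/= subr0 mulrC.
Qed.

(** The t-derivative is (W - ln (1 - t)) / t^2, as the two terms 1 / t cancel. It is positive on all
    of [al, be], since ln (1 - t) is largest at t = al. *)
Lemma log_median_increasing (W al be : R) : 0 < al -> al < be -> be < 1 -> ln (1 - al) < W ->
  ln al + (1 - al) / al * (ln (1 - al) - W) < ln be + (1 - be) / be * (ln (1 - be) - W).
Proof.
move=> al0 albe be1 hW.
pose g (t : R) := ln t + (1 - t) / t * (ln (1 - t) - W).
have dg (t : R) : al <= t <= be -> is_derive t 1 g ((W - ln (1 - t)) / t ^+ 2).
  move=> t0; have tp : 0 < t by lra.
  have t1 : 0 < 1 - t by lra.
  have d1 := is_derive1_ln tp.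
  have d2 : is_derive t 1 (@GRing.inv R) (- 1 / t ^+ 2) :=
    @is_derive_fV _ (fun t : R => t) t _ (lt0r_neq0 tp) (is_derive_fid t).
  rewrite /g; derive; first exact: t1.
  by field; rewrite !lt0r_neq0.
have [c c0 E] := MVT_is_derive albe dg.
rewrite -[ltLHS]/(g al) -[ltRHS]/(g be) -subr_gt0 E mulr_gt0//; last by rewrite subr_gt0.
have c1 : 0 < c by lra.
rewrite divr_gt0 ?exprn_gt0// subr_gt0 (le_lt_trans _ hW)// ler_ln ?posrE; lra.
Qed.

End comparison.

Theorem proposition4 (R : realType)
  (dZ : R -> measure_display) (TZ : forall alpha : R, measurableType (dZ alpha))
  (PZ : forall alpha : R, probability (TZ alpha) R)
  (Z : forall alpha : R, {RV (PZ alpha) >-> R})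
  (m : R -> R)
  (hZ : forall alpha : R, 0 < alpha < 1 -> is_positive_stable alpha (Z alpha))
  (hm : forall alpha : R, 0 < alpha < 1 -> is_median (PZ alpha) (Z alpha) (m alpha))
  (dX : measure_display) (TX : measurableType dX) (PX : probability TX R)
  (X : {RV PX >-> R}) (mS : R)
  (hX : is_log_S X)
  (hmS : is_median PX (fun w => expR (X w)) mS) :
  {in `]1 - mS, 1[ &, {homo m : alpha beta / alpha < beta}}.
Proof.
move=> al be; rewrite !in_itv/= => /andP[al0 al1] /andP[be0 be1] albe.
have [mS0 ES] := log_S_median hX hmS.
have mS1 : 0 <= 1 - mS by rewrite subr_ge0 (scale_zolotarev_S_le1 ES).
have al01 : 0 < al < 1 by rewrite al1 (le_lt_trans mS1 al0).
have be01 : 0 < be < 1 by rewrite be1 (le_lt_trans mS1 be0).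
have [al_gt0 be_gt0] : 0 < al /\ 0 < be by case/andP: al01 => ->; case/andP: be01.
have [ma0 Ea] := positive_stable_median al01 (hZ _ al01) (hm _ al01).
have [mb0 Eb] := positive_stable_median be01 (hZ _ be01) (hm _ be01).
rewrite -ltr_ln ?posrE// [ltRHS](ln_stable_weight be01 mb0) [ltLHS](ln_stable_weight al01 ma0).
(* The weight is frozen at its value for [be]: replacing the weight of [al] by this smaller one can
   only raise the expression, and what remains is the growth in alpha at a fixed weight, which is at
   least m_S and hence exceeds 1 - al. *)
apply: le_lt_trans (_ : ln al + (1 - al) / al * (ln (1 - al) - ln (stable_weight be (m be))) < _).
  rewrite lerD2l ler_wpM2l ?divr_ge0 ?subr_ge0 ?(ltW al1) ?(ltW al_gt0)//.
  by rewrite lerD2l lerN2 ler_ln ?posrE ?stable_weight_gt0//; exact: stable_weight_antitone Ea Eb.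
apply: log_median_increasing => //; rewrite ltr_ln ?posrE ?stable_weight_gt0 ?subr_gt0//.
by apply: lt_le_trans (le_stable_weight be_gt0 be1 Eb ES); rewrite ltrBlDr -ltrBlDl.
Qed.
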